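(* Let $\Omega\subset\mathbb{R}^{2}$ be a simply connected domain, let $q$ be a real valued function on $\Omega$, and let $f$ and $g$ be real valued, twice continuously differentiable, nonvanishing solutions in $\Omega$ of the Schrödinger equation $(-\Delta+q)u=0$. Let $z_{0}\in\Omega$, $a\in\mathbb{C}\setminus\{0\}$, $n\in\mathbb{N}=\{1,2,\ldots\}$, and let $Z_{f}^{(n)}(a,z_{0},z)$ be a formal power of order $n$, with center at $z_{0}$ and coefficient $a$, associated with the equation $$W_{\overline{z}}=\frac{f_{\overline{z}}}{f}\,\overline{W}\quad\text{in }\Omega.$$ Then the function $$Z_{g}^{(n)}(a,z_{0},z):=T_{f,g}\left[Z_{f}^{(n)}(a,z_{0},z)\right]$$ is a formal power of order $n$, with center at $z_{0}$ and coefficient $a$, associated with the equation $$w_{\overline{z}}=\frac{g_{\overline{z}}}{g}\,\overline{w}\quad\text{in }\Omega.$$ Here $T_{f,g}$ is the transplant operator $$T_{f,g}[W]=P^{+}W+ig^{-1}\overline{A}\left[ig^{2}\partial_{\overline{z}}(g^{-1}P^{+}W)\right],$$ where $$\overline{A}[\Phi](z)=2\int_{\Gamma}\left(\Phi_{1}\,dx+\Phi_{2}\,dy\right),\qquad \Phi=\Phi_1+i\Phi_2,$$ and $\Gamma$ is a rectifiable curve in $\Omega$ leading from $z_{0}$ to $z$ (that is, $z_{0}$ is chosen as the initial point of integration).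
   Context: Points $(x,y)\in\mathbb{R}^2$ are identified with complex numbers $z=x+iy$. The subindex $\overline{z}$ denotes application of $\partial_{\overline{z}}:=\frac12(\partial_x+i\partial_y)$. $P^{+}:=\frac12(I+C)$, where $I$ is the identity and $C$ is complex conjugation, so $P^{+}W=\operatorname{Re}W$. In $\overline{A}[\Phi]$, $\Phi_1$ and $\Phi_2$ are the real and imaginary parts of $\Phi$; the operator is applied to functions $\Phi$ satisfying $\partial_y\Phi_1-\partial_x\Phi_2=0$, and then $\partial_{\overline z}\overline{A}[\Phi]=\Phi$. Solutions of the equation $W_{\overline{z}}=\frac{f_{\overline{z}}}{f}\overline{W}$ are continuously differentiable complex valued functions $W$. Formal power: for $n\in\mathbb{N}$, $z_0\in\Omega$ and a complex number $a$, a formal power of order $n$ with center $z_0$ and coefficient $a$ associated with the equation $W_{\overline{z}}=\frac{f_{\overline{z}}}{f}\overline{W}$ is a solution $Z_f^{(n)}(a,z_0,z)$ of this equation in the whole domain $\Omega$ such that $$\lim_{z\to z_0}\frac{Z_f^{(n)}(a,z_0,z)}{a(z-z_0)^n}=1.$$ Formal powers associated with $w_{\overline{z}}=\frac{g_{\overline{z}}}{g}\overline{w}$ are defined in the same way with $g$ in place of $f$. *)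

(* Defs.v *)
From Stdlib Require Import Reals.
From Coquelicot Require Import Coquelicot.
From mathcomp Require seq.
Open Scope R_scope.

(* The plane R^2 is Coquelicot's C = R * R.  Functions on a domain Om are total
   functions on C of which only the values on Om matter. *)

Definition unit_interval (t : R) : Prop := 0 <= t <= 1.

Definition unit_square (p : R * R) : Prop :=
  unit_interval (fst p) /\ unit_interval (snd p).

Definition path_in (Om : C -> Prop) (z0 z1 : C) (gam : R -> C) : Prop :=
  continuous_on unit_interval gam /\
  (forall t, unit_interval t -> Om (gam t)) /\
  gam 0 = z0 /\ gam 1 = z1.

Definition null_homotopic_in (Om : C -> Prop) (p : C) (gam : R -> C) : Prop :=
  exists H : R * R -> C,
    continuous_on unit_square H /\
    (forall x, unit_square x -> Om (H x)) /\
    (forall t, unit_interval t -> H (t, 0) = gam t) /\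
    (forall t, unit_interval t -> H (t, 1) = p) /\
    (forall s, unit_interval s -> H (0, s) = p /\ H (1, s) = p).

Definition simply_connected_domain (Om : C -> Prop) : Prop :=
  open Om /\
  (exists z, Om z) /\
  (forall z0 z1, Om z0 -> Om z1 -> exists gam, path_in Om z0 z1 gam) /\
  (forall p gam, path_in Om p p gam -> null_homotopic_in Om p gam).

Definition dx (u : C -> R) (z : C) : R := Derive (fun t => u (t, Im z)) (Re z).
Definition dy (u : C -> R) (z : C) : R := Derive (fun t => u (Re z, t)) (Im z).

Definition C1_on (Om : C -> Prop) (u : C -> R) : Prop :=
  forall z, Om z ->
    ex_derive (fun t => u (t, Im z)) (Re z) /\
    ex_derive (fun t => u (Re z, t)) (Im z) /\
    continuous (dx u) z /\ continuous (dy u) z.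

Definition C2_on (Om : C -> Prop) (u : C -> R) : Prop :=
  C1_on Om u /\ C1_on Om (dx u) /\ C1_on Om (dy u).

Definition laplacian (u : C -> R) (z : C) : R := dx (dx u) z + dy (dy u) z.

Definition schrodinger_solution (Om : C -> Prop) (q u : C -> R) : Prop :=
  forall z, Om z -> - laplacian u z + q z * u z = 0.

Open Scope C_scope.

Definition dzbar (W : C -> C) (z : C) : C :=
  / 2 * ((dx (fun w => Re (W w)) z, dx (fun w => Im (W w)) z)
         + Ci * (dy (fun w => Re (W w)) z, dy (fun w => Im (W w)) z)).

Definition vekua_solution (Om : C -> Prop) (f : C -> R) (W : C -> C) : Prop :=
  C1_on Om (fun z => Re (W z)) /\
  C1_on Om (fun z => Im (W z)) /\
  (forall z, Om z ->
     dzbar W z = dzbar (fun w => RtoC (f w)) z / RtoC (f z) * Cconj (W z)).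

Definition is_formal_power (Om : C -> Prop) (f : C -> R) (n : nat) (a z0 : C)
    (Z : C -> C) : Prop :=
  vekua_solution Om f Z /\
  filterlim (fun z : C => Z z / (a * Cpow (z - z0) n))
    (locally' z0) (locally (1 : C)).

Definition Pplus (W : C -> C) (z : C) : C := / 2 * (W z + Cconj (W z)).

Close Scope C_scope.

Definition rectifiable_curve (Om : C -> Prop) (z0 z1 : C) (gam : R -> C) : Prop :=
  path_in Om z0 z1 gam /\
  exists L : R, forall (n : nat) (t : nat -> R),
    (forall i, unit_interval (t i)) -> (forall i, t i <= t (S i)) ->
    sum_f_R0 (fun i => Cmod (gam (t (S i)) - gam (t i))%C) n <= L.

(* Riemann-Stieltjes sum of Phi_1 dx + Phi_2 dy along gam; same shape as
   Coquelicot's Riemann_sum: each item of SF_t is a pair of the right endpoint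
   of a subinterval and its tag. *)
Definition line_sum (Phi : C -> C) (gam : R -> C) (ptd : SF_seq) : R :=
  seq.foldr Rplus 0
    (seq.pairmap (fun x y : R * R =>
        Re (Phi (gam (snd y))) * (Re (gam (fst y)) - Re (gam (fst x)))
        + Im (Phi (gam (snd y))) * (Im (gam (fst y)) - Im (gam (fst x))))
      (SF_h ptd, 0) (SF_t ptd)).

Definition is_line_integral (Phi : C -> C) (gam : R -> C) (l : R) : Prop :=
  filterlim (line_sum Phi gam) (Riemann_fine 0 1) (locally l).

(* v is the common value of twice the line integral of Phi over all rectifiable
   curves in Om from z0 to z. *)
Definition is_Abar (Om : C -> Prop) (z0 : C) (Phi : C -> C) (z : C) (v : R) : Prop :=
  forall gam, rectifiable_curve Om z0 z gam ->
    exists l, is_line_integral Phi gam l /\ v = 2 * l.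

(* Meaningful where exists! v, is_Abar Om z0 Phi z v, which also forces some
   rectifiable curve from z0 to z to exist. *)
Definition Abar (Om : C -> Prop) (z0 : C) (Phi : C -> C) (z : C) : R :=
  iota (is_Abar Om z0 Phi z).

Open Scope C_scope.

Definition transplant_density (g : C -> R) (W : C -> C) (z : C) : C :=
  Ci * RtoC (g z) ^ 2 * dzbar (fun w => / RtoC (g w) * Pplus W w) z.

(* The formula for T_{f,g} involves f only through the equation solved by W. *)
Definition transplant (Om : C -> Prop) (z0 : C) (g : C -> R) (W : C -> C) (z : C) : C :=
  Pplus W z
  + Ci * / RtoC (g z) * RtoC (Abar Om z0 (transplant_density g W) z).

Close Scope C_scope.

(* Main.v *)
From Stdlib Require Import Reals Lra Lia Classical ClassicalChoice.
From Coquelicot Require Import Coquelicot.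
From mathcomp Require seq.
Require Import Defs.
Open Scope R_scope.

(** Write [W = u + i v] for the given solution and [h = g / f].  In real form the
    equation for [f] says that the rotated field [f^2 grad (u / f)] is the gradient of
    [f v] (rotated meaning that [(p, q)] becomes [(- q, p)]), and the transplant
    replaces [v] by the [w] for which the rotated field [g^2 grad (u / g)] is the
    gradient of [g w].  The integrand of the transplant is half of the latter field,
    so one has to show that it is a gradient on the domain, although [u] has only
    continuous first derivatives and the field need not be differentiable.

    The key is an explicit candidate for the potential.  The identity
    [g grad u - u grad g = h (f grad u - u grad f) - (u / f) f^2 grad h] turns the
    rotated field into [grad (g v) - omega] with
    [omega = v f grad h + u f (rotated grad h)].  The form [omega] has continuously
    differentiable coefficients, and it is closed: its curl vanishes by the equation
    for [W] together with [div (f^2 grad h) = f Laplacian g - g Laplacian f = 0],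
    which is where the common potential [q] is used ([form_closed]).  On a simply
    connected domain [omega] has a primitive [U] ([closed_form_primitive]), so
    [(g v - U) / 2] is a potential of the integrand, whose line integral is then
    independent of the rectifiable curve ([line_integral_gradient]).  This gives the
    equation for [g] ([transplant_vekua]).

    Since [W] vanishes at the centre, the same potential shows that the transplant
    differs from [W] by [(U - U z0) / g] times a unit ([transplant_difference]).
    The coefficients of [omega] are bounded by a multiple of [|W|], hence are of order
    [n] at the centre; so [U - U z0] is of order [n + 1] ([primitive_order]) and does
    not disturb the leading term of the formal power.

    The primitive of a closed form is built without integrating along continuous
    curves.  Integrals along right angles form a cocycle [E] on small squares: one
    has [E a b + E b c = E a c] there.  A sum of values of [E] along a fine chain replaces
    the integral, and two neighbouring chains form a ladder whose cells contribute
    nothing ([chain_ladder]).  This lifts a contracting homotopy to a real valued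
    function ([lift_over_unit_square]), from which values on loops vanish
    ([path_value_loop]). *)

(** * Squares and gradients in the plane *)

Definition square (c : C) (r : R) (z : C) : Prop :=
  Rabs (fst z - fst c) < r /\ Rabs (snd z - snd c) < r.

Definition continuous_in (D : C -> Prop) (u : C -> R) : Prop :=
  forall z, D z -> continuous u z.

Definition has_gradient (D : C -> Prop) (u ux uy : C -> R) : Prop :=
  forall z, D z ->
    is_derive (fun t => u (t, snd z)) (fst z) (ux z) /\
    is_derive (fun t => u (fst z, t)) (snd z) (uy z).

Lemma square_center c r : 0 < r -> square c r c.
Proof. intros Hr; split; rewrite Rminus_eq_0, Rabs_R0; exact Hr. Qed.

Lemma locally_square (P : C -> Prop) (z : C) :
  locally z P <-> exists r, 0 < r /\ forall w, square z r w -> P w.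
Proof.
  split.
  - intros [e He]; exists e; split; [apply cond_pos|].
    intros w Hw; apply He; exact Hw.
  - intros [r [Hr H]]; exists (mkposreal r Hr).
    intros w Hw; apply H; exact Hw.
Qed.

(** Balls of the product topology are squares, so continuity at a point can be
    stated with them. *)
Lemma continuous_square (u : C -> R) (z : C) :
  continuous u z <->
  forall e, 0 < e -> exists r, 0 < r /\ forall w, square z r w -> Rabs (u w - u z) < e.
Proof.
  split.
  - intros H e He.
    apply (locally_square (fun w => Rabs (u w - u z) < e)).
    exact (proj1 (filterlim_locally u (u z)) H (mkposreal e He)).
  - intros H; apply (filterlim_locally u (u z)); intros e.
    apply (locally_square (fun w => ball (u z) e (u w))).
    exact (H e (cond_pos e)).
Qed.

Lemma continuous_horizontal (u : C -> R) (x y : R) :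
  continuous u (x, y) -> continuous (fun t => u (t, y)) x.
Proof.
  intros H; apply (continuous_comp (fun t => (t, y) : C) u x); [|exact H].
  apply (continuous_comp_2 (fun t => t) (fun _ => y) (fun a b => (a, b) : C)).
  - apply continuous_id.
  - apply continuous_const.
  - apply (filterlim_ext (fun p : R * R => p)); [intros [? ?]; reflexivity|].
    apply filterlim_id.
Qed.

Lemma continuous_vertical (u : C -> R) (x y : R) :
  continuous u (x, y) -> continuous (fun t => u (x, t)) y.
Proof.
  intros H; apply (continuous_comp (fun t => (x, t) : C) u y); [|exact H].
  apply (continuous_comp_2 (fun _ => x) (fun t => t) (fun a b => (a, b) : C)).
  - apply continuous_const.
  - apply continuous_id.
  - apply (filterlim_ext (fun p : R * R => p)); [intros [? ?]; reflexivity|].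
    apply filterlim_id.
Qed.

Lemma continuity_2d_pt_of_continuous (u : C -> R) (x y : R) :
  continuous u (x, y) -> continuity_2d_pt (fun s t => u (s, t)) x y.
Proof.
  intros H e; destruct (proj1 (continuous_square u (x, y)) H e (cond_pos e)) as [r [Hr Hu]].
  exists (mkposreal r Hr); intros s t Hs Ht; apply (Hu (s, t)); split; assumption.
Qed.

Lemma square_subset (c : C) (r : R) (z : C) :
  square c r z -> exists e, 0 < e /\ forall w, square z e w -> square c r w.
Proof.
  intros [H1 H2].
  exists (Rmin (r - Rabs (fst z - fst c)) (r - Rabs (snd z - snd c))); split.
  - apply Rmin_glb_lt; lra.
  - intros w [W1 W2]; split.
    + replace (fst w - fst c) with ((fst w - fst z) + (fst z - fst c)) by ring.
      eapply Rle_lt_trans; [apply Rabs_triang|].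
      pose proof (Rmin_l (r - Rabs (fst z - fst c)) (r - Rabs (snd z - snd c))); lra.
    + replace (snd w - snd c) with ((snd w - snd z) + (snd z - snd c)) by ring.
      eapply Rle_lt_trans; [apply Rabs_triang|].
      pose proof (Rmin_r (r - Rabs (fst z - fst c)) (r - Rabs (snd z - snd c))); lra.
Qed.

(** Partial derivatives at a point of an open set depend only on the values there. *)
Lemma has_gradient_ext_loc (D : C -> Prop) (u v ux uy : C -> R) :
  open D -> (forall z, D z -> u z = v z) ->
  has_gradient D u ux uy -> has_gradient D v ux uy.
Proof.
  intros HD E H z Hz.
  destruct (proj1 (locally_square D z) (HD z Hz)) as [r [Hr Hs]].
  destruct (H z Hz) as [Hx Hy]; split.
  - eapply is_derive_ext_loc; [|exact Hx].
    exists (mkposreal r Hr); intros t Ht; apply E, Hs; split; simpl.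
    + exact Ht.
    + rewrite Rminus_eq_0, Rabs_R0; exact Hr.
  - eapply is_derive_ext_loc; [|exact Hy].
    exists (mkposreal r Hr); intros t Ht; apply E, Hs; split; simpl.
    + rewrite Rminus_eq_0, Rabs_R0; exact Hr.
    + exact Ht.
Qed.

Lemma has_gradient_eq (D : C -> Prop) (u ux uy vx vy : C -> R) :
  (forall z, D z -> ux z = vx z) -> (forall z, D z -> uy z = vy z) ->
  has_gradient D u ux uy -> has_gradient D u vx vy.
Proof.
  intros Ex Ey H z Hz; rewrite <- (Ex z Hz), <- (Ey z Hz); exact (H z Hz).
Qed.

Lemma has_gradient_const (D : C -> Prop) (k : R) :
  has_gradient D (fun _ => k) (fun _ => 0) (fun _ => 0).
Proof. intros z _; split; apply (is_derive_const k). Qed.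

Lemma has_gradient_minus D u ux uy v vx vy :
  has_gradient D u ux uy -> has_gradient D v vx vy ->
  has_gradient D (fun z => u z - v z) (fun z => ux z - vx z) (fun z => uy z - vy z).
Proof.
  intros Hu Hv z Hz; destruct (Hu z Hz), (Hv z Hz); split.
  - apply (is_derive_minus (fun t => u (t, snd z)) (fun t => v (t, snd z))); assumption.
  - apply (is_derive_minus (fun t => u (fst z, t)) (fun t => v (fst z, t))); assumption.
Qed.

Lemma has_gradient_plus D u ux uy v vx vy :
  has_gradient D u ux uy -> has_gradient D v vx vy ->
  has_gradient D (fun z => u z + v z) (fun z => ux z + vx z) (fun z => uy z + vy z).
Proof.
  intros Hu Hv z Hz; destruct (Hu z Hz), (Hv z Hz); split.
  - apply (is_derive_plus (fun t => u (t, snd z)) (fun t => v (t, snd z))); assumption.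
  - apply (is_derive_plus (fun t => u (fst z, t)) (fun t => v (fst z, t))); assumption.
Qed.

Lemma has_gradient_mult D u ux uy v vx vy :
  has_gradient D u ux uy -> has_gradient D v vx vy ->
  has_gradient D (fun z => u z * v z) (fun z => ux z * v z + u z * vx z)
    (fun z => uy z * v z + u z * vy z).
Proof.
  intros Hu Hv z Hz; destruct (Hu z Hz), (Hv z Hz); split; destruct z as [x y].
  - apply (is_derive_mult (fun t => u (t, y)) (fun t => v (t, y))); try assumption.
    exact Rmult_comm.
  - apply (is_derive_mult (fun t => u (x, t)) (fun t => v (x, t))); try assumption.
    exact Rmult_comm.
Qed.

Lemma has_gradient_div D u ux uy v vx vy :
  (forall z, D z -> v z <> 0) ->
  has_gradient D u ux uy -> has_gradient D v vx vy ->
  has_gradient D (fun z => u z / v z)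
    (fun z => (ux z * v z - u z * vx z) / v z ^ 2)
    (fun z => (uy z * v z - u z * vy z) / v z ^ 2).
Proof.
  intros Hn Hu Hv z Hz; specialize (Hn z Hz).
  destruct (Hu z Hz), (Hv z Hz); split; destruct z as [x y].
  - apply (is_derive_div (fun t => u (t, y)) (fun t => v (t, y))); assumption.
  - apply (is_derive_div (fun t => u (x, t)) (fun t => v (x, t))); assumption.
Qed.

Lemma continuous_in_minus D u v :
  continuous_in D u -> continuous_in D v -> continuous_in D (fun z => u z - v z).
Proof. intros Hu Hv z Hz; apply (continuous_minus u v); [apply Hu | apply Hv]; exact Hz. Qed.

Lemma continuous_in_plus D u v :
  continuous_in D u -> continuous_in D v -> continuous_in D (fun z => u z + v z).
Proof. intros Hu Hv z Hz; apply (continuous_plus u v); [apply Hu | apply Hv]; exact Hz. Qed.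

Lemma continuous_in_mult D u v :
  continuous_in D u -> continuous_in D v -> continuous_in D (fun z => u z * v z).
Proof.
  intros Hu Hv z Hz; apply (continuous_mult (K := R_AbsRing) u v);
    [apply Hu | apply Hv]; exact Hz.
Qed.

Lemma continuous_in_div D u v :
  (forall z, D z -> v z <> 0) ->
  continuous_in D u -> continuous_in D v -> continuous_in D (fun z => u z / v z).
Proof.
  intros Hn Hu Hv; apply continuous_in_mult; [exact Hu|].
  intros z Hz; apply (continuous_comp v Rinv); [exact (Hv z Hz)|].
  apply continuous_Rinv, Hn, Hz.
Qed.

(** A point moves from [a] to [b] along the horizontal and then the vertical side
    of a right angle; [corner a b] is this path as a set.  Partial derivatives
    control a function along it without any differentiability in two variables. *)
Definition corner (a b w : C) : Prop :=
  (Rmin (fst a) (fst b) <= fst w <= Rmax (fst a) (fst b) /\ snd w = snd a) \/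
  (fst w = fst b /\ Rmin (snd a) (snd b) <= snd w <= Rmax (snd a) (snd b)).

Lemma Rabs_between (s t c x r : R) :
  Rabs (s - c) < r -> Rabs (t - c) < r -> Rmin s t <= x <= Rmax s t ->
  Rabs (x - c) < r.
Proof.
  intros Hs Ht; apply Rabs_def2 in Hs; apply Rabs_def2 in Ht.
  unfold Rmin, Rmax; destruct (Rle_dec s t); intros; apply Rabs_def1; lra.
Qed.

Lemma square_corner (c : C) (r : R) (a b w : C) :
  square c r a -> square c r b -> corner a b w -> square c r w.
Proof.
  intros [A1 A2] [B1 B2] [[H1 H2]|[H1 H2]]; split.
  - exact (Rabs_between _ _ _ _ _ A1 B1 H1).
  - rewrite H2; exact A2.
  - rewrite H1; exact B1.
  - exact (Rabs_between _ _ _ _ _ A2 B2 H2).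
Qed.

Lemma mvt_bound (h h' : R -> R) (s t p M : R) :
  (forall x, Rmin s t <= x <= Rmax s t ->
     is_derive h x (h' x) /\ Rabs (h' x - p) <= M) ->
  Rabs (h t - h s - p * (t - s)) <= M * Rabs (t - s).
Proof.
  intros H; destruct (MVT_gen h s t h') as [c [Hc E]].
  - intros x Hx; apply H; lra.
  - intros x Hx; apply derivable_continuous_pt; exists (h' x).
    apply is_derive_Reals, H, Hx.
  - rewrite E.
    replace (h' c * (t - s) - p * (t - s)) with ((h' c - p) * (t - s)) by ring.
    rewrite Rabs_mult; apply Rmult_le_compat_r; [apply Rabs_pos|].
    apply H, Hc.
Qed.

Lemma corner_mvt (D : C -> Prop) (u ux uy : C -> R) (a b : C) (p q M : R) :
  has_gradient D u ux uy ->
  (forall w, corner a b w -> D w /\ Rabs (ux w - p) <= M /\ Rabs (uy w - q) <= M) ->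
  Rabs (u b - u a - (p * (fst b - fst a) + q * (snd b - snd a)))
    <= M * (Rabs (fst b - fst a) + Rabs (snd b - snd a)).
Proof.
  intros Hg Hc; destruct a as [a1 a2], b as [b1 b2]; simpl.
  assert (H1 : Rabs (u (b1, a2) - u (a1, a2) - p * (b1 - a1)) <= M * Rabs (b1 - a1)).
  { apply (mvt_bound (fun t => u (t, a2)) (fun t => ux (t, a2))); intros x Hx.
    destruct (Hc (x, a2)) as [HD [HM _]]; [left; simpl; auto|].
    split; [exact (proj1 (Hg _ HD)) | exact HM]. }
  assert (H2 : Rabs (u (b1, b2) - u (b1, a2) - q * (b2 - a2)) <= M * Rabs (b2 - a2)).
  { apply (mvt_bound (fun t => u (b1, t)) (fun t => uy (b1, t))); intros x Hx.
    destruct (Hc (b1, x)) as [HD [_ HM]]; [right; simpl; auto|].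
    split; [exact (proj2 (Hg _ HD)) | exact HM]. }
  replace (u (b1, b2) - u (a1, a2) - (p * (b1 - a1) + q * (b2 - a2))) with
    ((u (b1, a2) - u (a1, a2) - p * (b1 - a1)) +
     (u (b1, b2) - u (b1, a2) - q * (b2 - a2))) by ring.
  eapply Rle_trans; [apply Rabs_triang | lra].
Qed.

(** Continuity of the partial derivatives makes the first order approximation uniform
    in the increment and in the point [c] where the derivatives are evaluated; line
    sums need this because their tags are not subdivision points. *)
Lemma gradient_approximation (D : C -> Prop) (u ux uy : C -> R) (z : C) (e : R) :
  open D -> has_gradient D u ux uy -> continuous_in D ux -> continuous_in D uy ->
  D z -> 0 < e ->
  exists r, 0 < r /\ (forall w, square z r w -> D w) /\
    forall a b c, square z r a -> square z r b -> square z r c ->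
    Rabs (u b - u a - (ux c * (fst b - fst a) + uy c * (snd b - snd a)))
      <= e * (Rabs (fst b - fst a) + Rabs (snd b - snd a)).
Proof.
  intros HD Hg Hx Hy Hz He.
  destruct (proj1 (locally_square D z) (HD z Hz)) as [r0 [R0 S0]].
  assert (He2 : 0 < e / 2) by lra.
  destruct (proj1 (continuous_square ux z) (Hx z Hz) _ He2) as [r1 [R1 S1]].
  destruct (proj1 (continuous_square uy z) (Hy z Hz) _ He2) as [r2 [R2 S2]].
  set (r := Rmin r0 (Rmin r1 r2)).
  assert (Hr : r <= r0 /\ r <= r1 /\ r <= r2).
  { unfold r; pose proof (Rmin_l r0 (Rmin r1 r2)); pose proof (Rmin_r r0 (Rmin r1 r2)).
    pose proof (Rmin_l r1 r2); pose proof (Rmin_r r1 r2); lra. }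
  assert (sub : forall r', r <= r' -> forall w, square z r w -> square z r' w)
    by (intros r' Hr' w [? ?]; split; lra).
  exists r; split; [|split].
  - repeat apply Rmin_glb_lt; assumption.
  - intros w Hw; apply S0, (sub r0); tauto.
  - intros a b c Ha Hb Hc; apply (corner_mvt D u ux uy); [exact Hg|].
    intros w Hw; pose proof (square_corner z r a b w Ha Hb Hw) as Sw.
    split; [apply S0, (sub r0); tauto|].
    assert (half : forall h : C -> R, Rabs (h w - h z) < e / 2 -> Rabs (h c - h z) < e / 2 ->
              Rabs (h w - h c) <= e).
    { intros h K1 K2; replace (h w - h c) with ((h w - h z) - (h c - h z)) by ring.
      eapply Rle_trans; [apply Rabs_triang|]; rewrite Rabs_Ropp; lra. }
    split; apply half; (apply S1 || apply S2); apply (sub _ ); tauto.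
Qed.

(** Continuous differentiability is expressed by partial derivatives alone, so
    continuity of the function itself has to be derived from it. *)
Lemma continuous_in_gradient (D : C -> Prop) (u ux uy : C -> R) :
  open D -> has_gradient D u ux uy -> continuous_in D ux -> continuous_in D uy ->
  continuous_in D u.
Proof.
  intros HD Hg Hx Hy z Hz; apply continuous_square; intros e He.
  destruct (gradient_approximation D u ux uy z 1 HD Hg Hx Hy Hz Rlt_0_1)
    as [r [Hr [_ H]]].
  pose (K := Rabs (ux z) + Rabs (uy z) + 2).
  assert (HK : 0 < K)
    by (unfold K; pose proof (Rabs_pos (ux z)); pose proof (Rabs_pos (uy z)); lra).
  exists (Rmin r (e / K)); split.
  { apply Rmin_glb_lt; [exact Hr | apply Rdiv_lt_0_compat; assumption]. }
  intros w [W1 W2].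
  pose proof (Rmin_l r (e / K)); pose proof (Rmin_r r (e / K)).
  assert (B : Rabs (u w - u z - (ux z * (fst w - fst z) + uy z * (snd w - snd z)))
      <= 1 * (Rabs (fst w - fst z) + Rabs (snd w - snd z))).
  { apply H; try apply square_center; try exact Hr; split; lra. }
  replace (u w - u z) with
    ((u w - u z - (ux z * (fst w - fst z) + uy z * (snd w - snd z))) +
     (ux z * (fst w - fst z) + uy z * (snd w - snd z))) by ring.
  eapply Rle_lt_trans; [apply Rabs_triang|].
  pose proof (Rabs_triang (ux z * (fst w - fst z)) (uy z * (snd w - snd z))) as T.
  rewrite !Rabs_mult in T.
  set (x := Rabs (fst w - fst z)) in *; set (y := Rabs (snd w - snd z)) in *.
  assert (X : x < e / K) by lra; assert (Y : y < e / K) by lra.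
  assert (E : e = K * (e / K)) by (field; lra).
  set (m := e / K) in *.
  pose proof (Rabs_pos (ux z)); pose proof (Rabs_pos (uy z)).
  assert (Rabs (ux z) * x <= Rabs (ux z) * m) by (apply Rmult_le_compat_l; lra).
  assert (Rabs (uy z) * y <= Rabs (uy z) * m) by (apply Rmult_le_compat_l; lra).
  rewrite E; unfold K; nra.
Qed.

Lemma C1_on_gradient (D : C -> Prop) (u : C -> R) :
  C1_on D u -> has_gradient D u (dx u) (dy u) /\ continuous_in D (dx u) /\
               continuous_in D (dy u).
Proof.
  intros H; split; [|split]; intros z Hz; destruct (H z Hz) as [Hx [Hy [Cx Cy]]]; auto.
  split; apply Derive_correct; assumption.
Qed.

Lemma has_gradient_dx D u ux uy z : has_gradient D u ux uy -> D z -> dx u z = ux z.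
Proof. intros H Hz; apply is_derive_unique, (H z Hz). Qed.

Lemma has_gradient_dy D u ux uy z : has_gradient D u ux uy -> D z -> dy u z = uy z.
Proof. intros H Hz; apply is_derive_unique, (H z Hz). Qed.

Lemma gradient_C1_on (D : C -> Prop) (u ux uy : C -> R) :
  open D -> has_gradient D u ux uy -> continuous_in D ux -> continuous_in D uy ->
  C1_on D u.
Proof.
  intros HD H Cx Cy z Hz; destruct (H z Hz) as [Hx Hy].
  split; [eexists; exact Hx|]; split; [eexists; exact Hy|].
  assert (L : locally z D) by exact (HD z Hz).
  split.
  - apply (continuous_ext_loc _ ux); [|exact (Cx z Hz)].
    apply (filter_imp D); [|exact L].
    intros w Hw; symmetry; exact (has_gradient_dx _ _ _ _ _ H Hw).
  - apply (continuous_ext_loc _ uy); [|exact (Cy z Hz)].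
    apply (filter_imp D); [|exact L].
    intros w Hw; symmetry; exact (has_gradient_dy _ _ _ _ _ H Hw).
Qed.

Lemma mixed_derivatives (D : C -> Prop) (u : C -> R) (z : C) :
  open D -> C2_on D u -> D z -> dx (dy u) z = dy (dx u) z.
Proof.
  intros HD [H0 [Hx Hy]] Hz; destruct z as [x y].
  apply (Schwarz (fun s t => u (s, t)) x y).
  - apply (locally_2d_locally _ x y).
    apply (filter_imp D); [|exact (HD _ Hz)].
    intros w Hw.
    destruct (H0 w Hw) as [? [? _]]; destruct (Hx w Hw) as [? [? _]];
      destruct (Hy w Hw) as [? [? _]].
    repeat split; assumption.
  - apply (continuity_2d_pt_of_continuous (dx (dy u))).
    apply (Hy _ Hz).
  - apply (continuity_2d_pt_of_continuous (dy (dx u))).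
    apply (Hx _ Hz).
Qed.

(** * Local primitives of closed forms *)

Definition corner_integral (A B : C -> R) (a b : C) : R :=
  RInt (fun t => A (t, snd a)) (fst a) (fst b) +
  RInt (fun s => B (fst b, s)) (snd a) (snd b).

Lemma corner_integral_gradient (D : C -> Prop) (A B F : C -> R) (a b : C) :
  has_gradient D F A B -> continuous_in D A -> continuous_in D B ->
  (forall w, corner a b w -> D w) ->
  corner_integral A B a b = F b - F a.
Proof.
  intros HF HA HB Hc; destruct a as [a1 a2], b as [b1 b2]; unfold corner_integral; simpl.
  assert (Hh : forall x, Rmin a1 b1 <= x <= Rmax a1 b1 -> D (x, a2))
    by (intros x Hx; apply Hc; left; simpl; auto).
  assert (Hv : forall x, Rmin a2 b2 <= x <= Rmax a2 b2 -> D (b1, x))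
    by (intros x Hx; apply Hc; right; simpl; auto).
  rewrite (is_RInt_unique _ _ _ (F (b1, a2) - F (a1, a2))).
  rewrite (is_RInt_unique _ _ _ (F (b1, b2) - F (b1, a2))).
  - simpl; ring.
  - apply (is_RInt_derive (fun t => F (b1, t)) (fun t => B (b1, t))).
    + intros x Hx; apply (HF (b1, x)); auto.
    + intros x Hx; apply continuous_vertical, HB; auto.
  - apply (is_RInt_derive (fun t => F (t, a2)) (fun t => A (t, a2))).
    + intros x Hx; apply (HF (x, a2)); auto.
    + intros x Hx; apply continuous_horizontal, HA; auto.
Qed.

(** The fundamental theorem for an integrand that is continuous only near the
    interval of integration. *)
Lemma is_derive_RInt_endpoint (h : R -> R) (a x : R) (e : R) :
  0 < e ->
  (forall y, Rabs (y - x) < e -> forall t, Rmin a y <= t <= Rmax a y -> continuous h t) ->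
  is_derive (fun y => RInt h a y) x (h x).
Proof.
  intros He H; apply is_derive_RInt with (a := a).
  - exists (mkposreal e He); intros y Hy; apply RInt_correct, ex_RInt_continuous.
    apply H, Hy.
  - apply (H x); [rewrite Rminus_eq_0, Rabs_R0; exact He|].
    split; [apply Rmin_r | apply Rmax_r].
Qed.

(** Moving the end point vertically differentiates the last side.  Moving it
    horizontally differentiates the first side and, under the integral sign, the last
    one, where [dx B = dy A] turns the integrand into a derivative along the side. *)
Lemma closed_form_corner_primitive (D : C -> Prop) (A B : C -> R) (c : C) (r : R) :
  open D -> C1_on D A -> C1_on D B -> (forall z, D z -> dy A z = dx B z) ->
  0 < r -> (forall w, square c r w -> D w) ->
  has_gradient (square c r) (corner_integral A B c) A B.
Proof.
  intros HD HA HB Hcl Hr Hs z Hz.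
  destruct (C1_on_gradient D A HA) as [GA [CAx CAy]].
  destruct (C1_on_gradient D B HB) as [GB [CBx CBy]].
  pose proof (continuous_in_gradient _ _ _ _ HD GA CAx CAy) as CA.
  pose proof (continuous_in_gradient _ _ _ _ HD GB CBx CBy) as CB.
  destruct (square_subset c r z Hz) as [e [He Hsub]].
  assert (Hc : forall w v, square z e w -> corner c w v -> square c r v).
  { intros w v Hw; apply square_corner; [apply square_center, Hr | auto]. }
  destruct z as [x y], c as [c1 c2]; unfold corner_integral; simpl in *.
  assert (near_x : forall t, Rabs (t - x) < e -> square (x, y) e (t, y)).
  { intros t Ht; split; simpl; [exact Ht|]. rewrite Rminus_eq_0, Rabs_R0; exact He. }
  assert (near_y : forall t, Rabs (t - y) < e -> square (x, y) e (x, t)).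
  { intros t Ht; split; simpl; [|exact Ht]. rewrite Rminus_eq_0, Rabs_R0; exact He. }
  split.
  - assert (Hval : RInt (fun s => Derive (fun u => B (u, s)) x) c2 y = A (x, y) - A (x, c2)).
    { apply is_RInt_unique.
      apply (is_RInt_ext (fun s => dy A (x, s))).
      - intros s Hs'; rewrite Hcl; [reflexivity|].
        apply Hs, (Hc (x, y)); [apply square_center, He|].
        right; simpl; split; [reflexivity | lra].
      - apply (is_RInt_derive (fun s => A (x, s)) (fun s => dy A (x, s))).
        + intros s Hs'; apply (GA (x, s)), Hs, (Hc (x, y)); [apply square_center, He|].
          right; simpl; auto.
        + intros s Hs'; apply continuous_vertical, CAy, Hs, (Hc (x, y));
            [apply square_center, He|].
          right; simpl; auto. }
    replace (A (x, y)) with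
      (A (x, c2) + RInt (fun s => Derive (fun u => B (u, s)) x) c2 y) by (rewrite Hval; ring).
    apply (is_derive_plus (fun t => RInt (fun t => A (t, c2)) c1 t)
                          (fun t => RInt (fun s => B (t, s)) c2 y)).
    + apply (is_derive_RInt_endpoint (fun t => A (t, c2)) c1 x e He).
      intros t Ht s Hs'; apply continuous_horizontal, CA, Hs, (Hc (t, y)); [auto|].
      left; simpl; auto.
    + apply (is_derive_RInt_param (fun t s => B (t, s))).
      * exists (mkposreal e He); intros t Ht s Hs'.
        eexists; apply (GB (t, s)), Hs, (Hc (t, y)); [apply near_x, Ht|].
        right; simpl; auto.
      * intros s Hs'; apply (continuity_2d_pt_of_continuous (dx B)), CBx, Hs, (Hc (x, y));
          [apply square_center, He|].
        right; simpl; auto.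
      * exists (mkposreal e He); intros t Ht; apply (ex_RInt_continuous (V := R_CompleteNormedModule)); intros s Hs'.
        apply continuous_vertical, CB, Hs, (Hc (t, y)); [apply near_x, Ht|].
        right; simpl; auto.
  - replace (B (x, y)) with (0 + B (x, y)) by ring.
    apply (is_derive_plus (fun t => RInt (fun t => A (t, c2)) c1 x)
                          (fun t => RInt (fun s => B (x, s)) c2 t)).
    + apply (is_derive_const (RInt (fun t => A (t, c2)) c1 x)).
    + apply (is_derive_RInt_endpoint (fun s => B (x, s)) c2 y e He).
      intros t Ht s Hs'; apply continuous_vertical, CB, Hs, (Hc (x, t)); [auto|].
      right; simpl; auto.
Qed.

(** What remains of path integration once the path is forgotten: [E a b] stands for
    the integral from [a] to [b] inside a region where paths do not matter. *)
Definition cocycle_on (G : C -> Prop) (E : C -> C -> R) : Prop :=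
  forall a b c, G a -> G b -> G c -> E a b + E b c = E a c.

Definition local_cocycle (D : C -> Prop) (E : C -> C -> R) : Prop :=
  forall z, D z -> exists r, 0 < r /\ cocycle_on (square z r) E.

Lemma cocycle_diag G E a : cocycle_on G E -> G a -> E a a = 0.
Proof. intros H Ha; specialize (H a a a Ha Ha Ha); lra. Qed.

(** The only use of closedness in the global construction: integrals along right
    angles become a cocycle on small squares. *)
Lemma closed_form_local_increment (D : C -> Prop) (A B : C -> R) :
  open D -> C1_on D A -> C1_on D B -> (forall z, D z -> dy A z = dx B z) ->
  forall z, D z -> exists r, 0 < r /\
    exists F, has_gradient (square z r) F A B /\
      forall a b, square z r a -> square z r b -> corner_integral A B a b = F b - F a.
Proof.
  intros HD HA HB Hcl z Hz.
  destruct (proj1 (locally_square D z) (HD z Hz)) as [r [Hr Hs]].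
  exists r; split; [exact Hr|].
  pose proof (closed_form_corner_primitive D A B z r HD HA HB Hcl Hr Hs) as HF.
  exists (corner_integral A B z); split; [exact HF|].
  intros a b Ha Hb; apply (corner_integral_gradient (square z r)).
  - exact HF.
  - intros w Hw; destruct (C1_on_gradient D A HA) as [GA [CAx CAy]].
    exact (continuous_in_gradient _ _ _ _ HD GA CAx CAy w (Hs w Hw)).
  - intros w Hw; destruct (C1_on_gradient D B HB) as [GB [CBx CBy]].
    exact (continuous_in_gradient _ _ _ _ HD GB CBx CBy w (Hs w Hw)).
  - intros w Hw; exact (square_corner z r a b w Ha Hb Hw).
Qed.

(** * Compactness and connectedness of the parameter sets *)

Lemma continuous_on_square_nbhd (S : R * R -> Prop) (H : R * R -> C) (x : R * R) (e : R) :
  continuous_on S H -> S x -> 0 < e ->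
  exists d, 0 < d /\ forall y, S y -> square x d y -> square (H x) e (H y).
Proof.
  intros HC Hx He.
  destruct (HC x Hx (fun w => square (H x) e w)) as [d Hd].
  { exists (mkposreal e He); intros w Hw; exact Hw. }
  exists d; split; [apply cond_pos|]; intros y Hy Hxy; apply Hd; [exact Hxy | exact Hy].
Qed.

Lemma continuous_on_interval_nbhd (S : R -> Prop) (gam : R -> C) (t e : R) :
  continuous_on S gam -> S t -> 0 < e ->
  exists d, 0 < d /\ forall s, S s -> Rabs (s - t) < d -> square (gam t) e (gam s).
Proof.
  intros HC Ht He.
  destruct (HC t Ht (fun w => square (gam t) e w)) as [d Hd].
  { exists (mkposreal e He); intros w Hw; exact Hw. }
  exists d; split; [apply cond_pos|]; intros s Hs Hst; apply Hd; [exact Hst | exact Hs].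
Qed.

Lemma continuous_on_interval_intro (S : R -> Prop) (gam : R -> C) :
  (forall t e, S t -> 0 < e ->
     exists d, 0 < d /\ forall s, S s -> Rabs (s - t) < d -> square (gam t) e (gam s)) ->
  continuous_on S gam.
Proof.
  intros H t Ht P [e He].
  destruct (H t e Ht (cond_pos e)) as [d [Hd Hs]].
  exists (mkposreal d Hd); intros s Hst HS; apply He; exact (Hs s HS Hst).
Qed.

(** Lebesgue number lemma; [Good] holds of the sets that are small enough. *)
Lemma unit_square_lebesgue (Good : (R * R -> Prop) -> Prop) :
  (forall S T : R * R -> Prop, (forall y, S y -> T y) -> Good T -> Good S) ->
  (forall x, unit_square x -> exists d, 0 < d /\ Good (fun y => unit_square y /\ square x d y)) ->
  exists d, 0 < d /\
    forall x, unit_square x -> Good (fun y => unit_square y /\ square x d y).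
Proof.
  intros Hmono Hloc.
  destruct (choice (fun (x : R * R) (d : posreal) =>
      unit_square x -> Good (fun y => unit_square y /\ square x d y))) as [del Hdel].
  { intros x; destruct (classic (unit_square x)) as [Hx|Hx].
    - destruct (Hloc x Hx) as [d [Hd HG]]; exists (mkposreal d Hd); auto.
    - exists (mkposreal 1 Rlt_0_1); tauto. }
  assert (half : forall x, 0 < del x / 2) by (intros x; pose proof (cond_pos (del x)); lra).
  destruct (compactness_value_2d 0 1 0 1 (fun u v => mkposreal _ (half (u, v)))) as [d Hd].
  exists d; split; [apply cond_pos|].
  intros x [Hx1 Hx2].
  destruct (NNPP _ (Hd (fst x) (snd x) Hx1 Hx2)) as [u [v [Hu [Hv [Du [Dv Dd]]]]]].
  simpl in Du, Dv, Dd.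
  apply (Hmono _ (fun y => unit_square y /\ square (u, v) (del (u, v)) y)).
  - intros y [Hy [Y1 Y2]]; split; [exact Hy|].
    apply Rabs_def2 in Du; apply Rabs_def2 in Dv; apply Rabs_def2 in Y1;
      apply Rabs_def2 in Y2.
    split; simpl; apply Rabs_def1; lra.
  - apply Hdel; split; assumption.
Qed.

Lemma unit_interval_lebesgue (Good : (R -> Prop) -> Prop) :
  (forall S T : R -> Prop, (forall y, S y -> T y) -> Good T -> Good S) ->
  (forall t, unit_interval t ->
     exists d, 0 < d /\ Good (fun s => unit_interval s /\ Rabs (s - t) < d)) ->
  exists d, 0 < d /\
    forall t, unit_interval t -> Good (fun s => unit_interval s /\ Rabs (s - t) < d).
Proof.
  intros Hmono Hloc.
  assert (I0 : unit_interval 0) by (split; lra).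
  destruct (unit_square_lebesgue (fun S => Good (fun s => S (s, 0)))) as [d [Hd H]].
  - intros S T HST; apply Hmono; auto.
  - intros [t u] [Ht _]; destruct (Hloc t Ht) as [d [Hd H]]; exists d; split; [exact Hd|].
    eapply Hmono; [|exact H].
    intros s [[Hs _] [Hst _]]; split; assumption.
  - exists d; split; [exact Hd|]; intros t Ht.
    eapply Hmono; [|apply (H (t, 0)); split; assumption].
    intros s [Hs Hst]; split; split; simpl; auto.
    rewrite Rminus_eq_0, Rabs_R0; exact Hd.
Qed.

(** Connectedness of the interval: the supremum of the initial segments on which [P]
    holds can neither fail [P] nor be interior. *)
Lemma unit_interval_connected (P : R -> Prop) :
  (forall t, unit_interval t -> exists d, 0 < d /\
     forall s, unit_interval s -> Rabs (s - t) < d -> (P s <-> P t)) ->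
  P 0 -> forall t, unit_interval t -> P t.
Proof.
  intros Hloc H0 t1 Ht1.
  set (S := fun t => unit_interval t /\ forall s, 0 <= s <= t -> P s).
  assert (S0 : S 0).
  { split; [split; lra|]; intros s Hs; replace s with 0 by lra; exact H0. }
  destruct (completeness S) as [m [Hub Hlub]].
  { exists 1; intros t [[_ Ht] _]; exact Ht. }
  { exists 0; exact S0. }
  assert (Hm : unit_interval m).
  { split; [exact (Hub 0 S0) | apply Hlub; intros t [[_ Ht] _]; exact Ht]. }
  destruct (Hloc m Hm) as [d [Hd Hm']].
  assert (Hex : exists t, S t /\ m - d < t).
  { apply NNPP; intros Hn; assert (K : m <= m - d); [|lra].
    apply Hlub; intros t Ht; destruct (Rle_lt_dec t (m - d)) as [|L]; [assumption|].
    exfalso; apply Hn; exists t; tauto. }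
  destruct Hex as [t [[Ht HtP] Htm]].
  pose proof (Hub t (conj Ht HtP)) as Htm2.
  assert (Pm : P m).
  { apply (Hm' t Ht); [apply Rabs_def1; lra|]. apply HtP; destruct Ht; lra. }
  assert (HP : forall s, unit_interval s -> s < m + d -> P s).
  { intros s Hs Hsd; destruct (Rle_lt_dec s t) as [L|L].
    - apply HtP; destruct Hs; lra.
    - apply (Hm' s Hs); [apply Rabs_def1; lra | exact Pm]. }
  destruct (Rle_lt_dec (m + d) 1) as [L|L].
  - assert (K : m + d / 2 <= m); [|lra].
    apply Hub; split; [destruct Hm; split; lra|].
    intros s Hs; apply HP; [destruct Hm; split; lra | lra].
  - apply HP; [exact Ht1 | destruct Ht1; lra].
Qed.

(** This makes a primitive along a path unique up to a constant. *)
Lemma locally_constant_on_interval (h : R -> R) (d : R) :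
  0 < d ->
  (forall s t, unit_interval s -> unit_interval t -> Rabs (t - s) < d -> h t = h s) ->
  forall t, unit_interval t -> h t = h 0.
Proof.
  intros Hd H; apply (unit_interval_connected (fun t => h t = h 0)); [|reflexivity].
  intros t Ht; exists d; split; [exact Hd|]; intros s Hs Hst.
  rewrite (H t s Ht Hs Hst); tauto.
Qed.

(** * Local cocycles on simply connected domains are increments *)

Fixpoint chain_sum (E : C -> C -> R) (p : nat -> C) (k : nat) : R :=
  match k with
  | O => 0
  | S k => chain_sum E p k + E (p k) (p (S k))
  end.

(** Two chains with small rungs between them: each cell of the ladder contributes
    nothing, so only the first and the last rung remain. *)
Lemma chain_ladder (E : C -> C -> R) (p q : nat -> C) (k : nat) :
  (forall i, (i < k)%nat -> exists G, cocycle_on G E /\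
     G (p i) /\ G (p (S i)) /\ G (q i) /\ G (q (S i))) ->
  chain_sum E p k + E (p k) (q k) = E (p O) (q O) + chain_sum E q k.
Proof.
  induction k as [|k IH]; intros H; simpl; [ring|].
  assert (IH' := IH (fun i Hi => H i (Nat.lt_lt_succ_r _ _ Hi))).
  destruct (H k (Nat.lt_succ_diag_r k)) as [G [HE [P1 [P2 [Q1 Q2]]]]].
  pose proof (HE _ _ _ P1 P2 Q2); pose proof (HE _ _ _ P1 Q1 Q2); lra.
Qed.

Lemma Rmin_diff (s t k : R) : Rabs (Rmin t k - Rmin s k) <= Rabs (t - s).
Proof.
  unfold Rmin; destruct (Rle_dec t k), (Rle_dec s k);
    unfold Rabs; repeat destruct Rcase_abs; lra.
Qed.

(** The value of the lift at [x] is the sum of [E] along the image of the chain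
    which follows the diagonal of the square and stops each coordinate when it
    reaches that of [x].  Neighbouring points have chains that form a fine ladder. *)
Lemma lift_over_unit_square (D : C -> Prop) (E : C -> C -> R) (H : R * R -> C) :
  local_cocycle D E -> continuous_on unit_square H ->
  (forall x, unit_square x -> D (H x)) ->
  exists phi d, 0 < d /\
    forall x y, unit_square x -> unit_square y -> square x d y ->
    phi y - phi x = E (H x) (H y).
Proof.
  intros HE HC HD.
  destruct (unit_square_lebesgue (fun S => exists G, cocycle_on G E /\
              forall y, S y -> G (H y))) as [d [Hd Hs]].
  { intros S T HST [G [HG HT]]; exists G; auto. }
  { intros x Hx; destruct (HE (H x) (HD x Hx)) as [r [Hr Hco]].
    destruct (continuous_on_square_nbhd unit_square H x r HC Hx Hr) as [d [Hd Hsq]].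
    exists d; split; [exact Hd|]; exists (square (H x) r); split; [exact Hco|].
    intros y [Hy Hxy]; auto. }
  (* Steps and rungs are shorter than [d / 2], so the four corners of a cell lie
     within [d] of the first one. *)
  assert (Hd2 : 0 < d / 2) by lra.
  destruct (archimed_cor1 (d / 2) Hd2) as [N [HN HN0]].
  set (c := fun (x : R * R) (i : nat) =>
              (Rmin (fst x) (INR i / INR N), Rmin (snd x) (INR i / INR N))).
  assert (PN : 0 < INR N) by (apply lt_0_INR; exact HN0).
  assert (step : forall i, Rabs (INR (S i) / INR N - INR i / INR N) < d / 2).
  { intros i; rewrite S_INR; replace ((INR i + 1) / INR N - INR i / INR N) with (/ INR N)
      by (field; lra).
    rewrite Rabs_pos_eq; [exact HN|]; left; apply Rinv_0_lt_compat, PN. }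
  assert (csq : forall x i, unit_square x -> unit_square (c x i)).
  { intros x i [[A1 A2] [B1 B2]]; unfold c; split; split; simpl.
    1, 3: apply Rmin_glb; [assumption|]; apply Rmult_le_pos;
      [apply pos_INR | left; apply Rinv_0_lt_compat, PN].
    all: eapply Rle_trans; [apply Rmin_l | assumption]. }
  assert (c0 : forall x, unit_square x -> c x 0%nat = (0, 0)).
  { intros x [[A1 A2] [B1 B2]]; unfold c; simpl; unfold Rdiv; rewrite Rmult_0_l.
    rewrite !Rmin_right by assumption; reflexivity. }
  assert (cN : forall x, unit_square x -> c x N = x).
  { intros [x1 x2] [[A1 A2] [B1 B2]]; unfold c; simpl in *.
    replace (INR N / INR N) with 1 by (field; lra).
    rewrite !Rmin_left by assumption; reflexivity. }
  exists (fun x => chain_sum E (fun i => H (c x i)) N), (d / 2); split; [exact Hd2|].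
  intros x y Hx Hy [D1 D2].
  assert (L : chain_sum E (fun i => H (c x i)) N + E (H (c x N)) (H (c y N)) =
              E (H (c x 0%nat)) (H (c y 0%nat)) + chain_sum E (fun i => H (c y i)) N).
  { apply (chain_ladder E (fun i => H (c x i)) (fun i => H (c y i))).
    intros i _; destruct (Hs (c x i) (csq x i Hx)) as [G [HG Hy']].
    exists G; split; [exact HG|].
    assert (bound : forall s t k l, Rabs (t - s) < d / 2 -> Rabs (l - k) < d / 2 ->
              Rabs (Rmin t l - Rmin s k) < d).
    { intros s t k l Hst Hkl.
      pose proof (Rmin_diff s t l) as M1.
      pose proof (Rmin_diff k l s) as M2; rewrite !(Rmin_comm _ s) in M2.
      replace (Rmin t l - Rmin s k) with ((Rmin t l - Rmin s l) + (Rmin s l - Rmin s k)) by ring.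
      eapply Rle_lt_trans; [apply Rabs_triang | lra]. }
    assert (Z : forall u, Rabs (u - u) < d / 2)
      by (intros u; rewrite Rminus_eq_0, Rabs_R0; exact Hd2).
    repeat split; apply Hy'; (split; [apply csq; assumption|]);
      split; apply bound; auto. }
  rewrite !cN, !c0 in L by assumption.
  destruct (HE (H (0, 0))) as [r [Hr Hco]].
  { apply HD; split; split; simpl; lra. }
  rewrite (cocycle_diag _ _ _ Hco (square_center _ _ Hr)) in L; lra.
Qed.

Definition lipschitz_on_interval (K : R) (gam : R -> C) : Prop :=
  forall s t, unit_interval s -> unit_interval t ->
    Cmod (gam t - gam s)%C <= K * Rabs (t - s).

Lemma lipschitz_continuous (K : R) (gam : R -> C) :
  lipschitz_on_interval K gam -> continuous_on unit_interval gam.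
Proof.
  intros H; apply continuous_on_interval_intro; intros t e Ht He.
  pose (k := Rabs K + 1).
  assert (Hk : 0 < k) by (unfold k; pose proof (Rabs_pos K); lra).
  exists (e / k); split; [apply Rdiv_lt_0_compat; assumption|].
  intros s Hs Hst.
  assert (B : Cmod (gam s - gam t)%C < e).
  { eapply Rle_lt_trans; [apply H; assumption|].
    apply Rle_lt_trans with (k * Rabs (s - t)).
    - apply Rmult_le_compat_r; [apply Rabs_pos|]; unfold k; pose proof (Rle_abs K); lra.
    - apply Rlt_le_trans with (k * (e / k)).
      + apply Rmult_lt_compat_l; assumption.
      + right; field; lra. }
  pose proof (Rmax_Cmod (gam s - gam t)%C) as M.
  pose proof (Rmax_l (Rabs (fst (gam s - gam t)%C)) (Rabs (snd (gam s - gam t)%C))).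
  pose proof (Rmax_r (Rabs (fst (gam s - gam t)%C)) (Rabs (snd (gam s - gam t)%C))).
  simpl in *; split; unfold Rminus; lra.
Qed.

Definition segment (a b : C) (t : R) : C := (a + RtoC t * (b - a))%C.

Lemma segment_0 a b : segment a b 0 = a.
Proof. unfold segment; ring. Qed.

Lemma segment_1 a b : segment a b 1 = b.
Proof. unfold segment; ring. Qed.

Lemma segment_in_square c r a b t :
  square c r a -> square c r b -> unit_interval t -> square c r (segment a b t).
Proof.
  destruct c as [c1 c2], a as [a1 a2], b as [b1 b2].
  assert (between : forall x y, Rmin x y <= x + t * (y - x) <= Rmax x y \/ ~ unit_interval t).
  { intros x y; destruct (classic (unit_interval t)) as [[T0 T1]|]; [left|tauto].
    unfold Rmin, Rmax; destruct (Rle_dec x y); nra. }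
  intros [A1 A2] [B1 B2] HT; unfold segment; split; simpl in *.
  - apply (Rabs_between a1 b1); [assumption..|].
    destruct (between a1 b1); [lra | tauto].
  - apply (Rabs_between a2 b2); [assumption..|].
    destruct (between a2 b2); [lra | tauto].
Qed.

Lemma segment_lipschitz a b : lipschitz_on_interval (Cmod (b - a)%C) (segment a b).
Proof.
  intros s t _ _; right; unfold segment.
  replace (a + RtoC t * (b - a) - (a + RtoC s * (b - a)))%C with
    (RtoC (t - s) * (b - a))%C by (rewrite RtoC_minus; ring).
  rewrite Cmod_mult, Cmod_R; ring.
Qed.

Lemma segment_path (D : C -> Prop) c r a b :
  (forall w, square c r w -> D w) -> square c r a -> square c r b ->
  path_in D a b (segment a b).
Proof.
  intros Hs Ha Hb; split; [|split; [|split]].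
  - exact (lipschitz_continuous _ _ (segment_lipschitz a b)).
  - intros t Ht; apply Hs, segment_in_square; assumption.
  - apply segment_0.
  - apply segment_1.
Qed.

(** Concatenation written without a case distinction, so that it inherits continuity
    and Lipschitz bounds from its parts; [concat_left] and [concat_right] recover
    the two halves. *)
Definition concat (gam eta : R -> C) (t : R) : C :=
  (gam (Rmin 1 (2 * t)) + (eta (Rmax 0 (2 * t - 1)) - eta 0))%C.

Lemma concat_left gam eta t : t <= 1 / 2 -> concat gam eta t = gam (2 * t).
Proof.
  intros Ht; unfold concat; rewrite Rmin_right, Rmax_left by lra; ring.
Qed.

Lemma concat_right gam eta t :
  gam 1 = eta 0 -> 1 / 2 <= t -> concat gam eta t = eta (2 * t - 1).
Proof.
  intros E Ht; unfold concat; rewrite Rmin_left, Rmax_right, E by lra; ring.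
Qed.

Lemma concat_parameters s t :
  unit_interval s -> unit_interval t ->
  (unit_interval (Rmin 1 (2 * t)) /\ unit_interval (Rmax 0 (2 * t - 1))) /\
  Rabs (Rmin 1 (2 * t) - Rmin 1 (2 * s)) <= 2 * Rabs (t - s) /\
  Rabs (Rmax 0 (2 * t - 1) - Rmax 0 (2 * s - 1)) <= 2 * Rabs (t - s).
Proof.
  intros [S0 S1] [T0 T1]; unfold unit_interval, Rmin, Rmax.
  repeat destruct Rle_dec; unfold Rabs; repeat destruct Rcase_abs; lra.
Qed.

Lemma concat_lipschitz K L gam eta :
  0 <= K -> 0 <= L ->
  lipschitz_on_interval K gam -> lipschitz_on_interval L eta ->
  lipschitz_on_interval (2 * (K + L)) (concat gam eta).
Proof.
  intros HK HL H1 H2 s t Hs Ht; unfold concat.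
  destruct (concat_parameters t s Ht Hs) as [[P3 P4] _].
  destruct (concat_parameters s t Hs Ht) as [[P1 P2] [B1 B2]].
  specialize (H1 _ _ P3 P1); specialize (H2 _ _ P4 P2).
  set (p := gam (Rmin 1 (2 * t))) in *; set (p' := gam (Rmin 1 (2 * s))) in *.
  set (q := eta (Rmax 0 (2 * t - 1))) in *; set (q' := eta (Rmax 0 (2 * s - 1))) in *.
  replace (p + (q - eta 0) - (p' + (q' - eta 0)))%C with ((p - p') + (q - q'))%C by ring.
  eapply Rle_trans; [apply Cmod_triangle|]; nra.
Qed.

Lemma concat_path D a b c gam eta :
  path_in D a b gam -> path_in D b c eta -> path_in D a c (concat gam eta).
Proof.
  intros [C1 [D1 [S1 E1]]] [C2 [D2 [S2 E2]]].
  assert (J : gam 1 = eta 0) by congruence.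
  split; [|split; [|split]].
  - apply continuous_on_interval_intro; intros t e Ht He.
    destruct (concat_parameters t t Ht Ht) as [[P1 P2] _].
    assert (He2 : 0 < e / 2) by lra.
    destruct (continuous_on_interval_nbhd _ _ _ _ C1 P1 He2) as [d1 [Hd1 N1]].
    destruct (continuous_on_interval_nbhd _ _ _ _ C2 P2 He2) as [d2 [Hd2 N2]].
    exists (Rmin d1 d2 / 2); split.
    { pose proof (Rmin_glb_lt _ _ _ Hd1 Hd2); lra. }
    intros s Hs Hst; destruct (concat_parameters t s Ht Hs) as [[Q1 Q2] [B1 B2]].
    pose proof (Rmin_l d1 d2); pose proof (Rmin_r d1 d2).
    destruct (N1 _ Q1) as [U1 U2]; [lra|]; destruct (N2 _ Q2) as [V1 V2]; [lra|].
    unfold concat.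
    apply Rabs_def2 in U1; apply Rabs_def2 in U2; apply Rabs_def2 in V1; apply Rabs_def2 in V2.
    split; simpl; apply Rabs_def1; lra.
  - intros t [T0 T1]; destruct (Rle_lt_dec t (1 / 2)).
    + rewrite concat_left by assumption; apply D1; split; lra.
    + rewrite concat_right by (assumption || lra); apply D2; split; lra.
  - rewrite concat_left by lra; rewrite Rmult_0_r; exact S1.
  - rewrite concat_right by (assumption || lra).
    replace (2 * 1 - 1) with 1 by ring; exact E2.
Qed.

Definition reverse (gam : R -> C) (t : R) : C := gam (1 - t).

Lemma unit_interval_flip t : unit_interval t -> unit_interval (1 - t).
Proof. intros [? ?]; split; lra. Qed.

Lemma reverse_path D a b gam : path_in D a b gam -> path_in D b a (reverse gam).
Proof.
  intros [Cg [Dg [S1 E1]]]; unfold reverse; split; [|split; [|split]].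
  - apply continuous_on_interval_intro; intros t e Ht He.
    destruct (continuous_on_interval_nbhd _ _ _ _ Cg (unit_interval_flip t Ht) He)
      as [d [Hd H]].
    exists d; split; [exact Hd|]; intros s Hs Hst; apply H.
    + apply unit_interval_flip, Hs.
    + replace (1 - s - (1 - t)) with (- (s - t)) by ring; rewrite Rabs_Ropp; exact Hst.
  - intros t Ht; apply Dg, unit_interval_flip, Ht.
  - rewrite Rminus_0_r; exact E1.
  - rewrite Rminus_diag; exact S1.
Qed.

Definition increment_along (E : C -> C -> R) (gam : R -> C) (phi : R -> R) : Prop :=
  exists d, 0 < d /\ forall s t, unit_interval s -> unit_interval t ->
    Rabs (t - s) < d -> phi t - phi s = E (gam s) (gam t).

(** The integral of the cocycle along a merely continuous path. *)
Definition path_value (E : C -> C -> R) (gam : R -> C) (v : R) : Prop :=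
  exists phi, increment_along E gam phi /\ phi 1 - phi 0 = v.

Lemma path_value_exists D E a b gam :
  local_cocycle D E -> path_in D a b gam -> exists v, path_value E gam v.
Proof.
  intros HE [Cg [Dg _]].
  destruct (lift_over_unit_square D E (fun x => gam (fst x))) as [phi [d [Hd H]]].
  - exact HE.
  - intros x [Hx _].
    apply (filterlim_comp _ _ _ fst gam _ (within unit_interval (locally (fst x))));
      [|apply Cg, Hx].
    intros P [e He]; exists e; intros y [Hy _] [Iy _]; apply He; assumption.
  - intros x [Hx _]; apply Dg, Hx.
  - exists (phi (1, 0) - phi (0, 0)), (fun t => phi (t, 0)); split; [|reflexivity].
    exists d; split; [exact Hd|]; intros s t Hs Ht Hst.
    assert (I0 : unit_interval 0) by (split; lra).
    apply (H (s, 0) (t, 0)); try (split; assumption).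
    split; simpl; [exact Hst|]; rewrite Rminus_eq_0, Rabs_R0; exact Hd.
Qed.

Lemma path_value_unique E gam v w : path_value E gam v -> path_value E gam w -> v = w.
Proof.
  intros [phi [[d [Hd H]] <-]] [psi [[e [He H']] <-]].
  assert (K := locally_constant_on_interval (fun t => phi t - psi t) (Rmin d e)
                 (Rmin_glb_lt _ _ _ Hd He)).
  assert (K1 : phi 1 - psi 1 = phi 0 - psi 0); [|lra].
  apply K; [|split; lra]; intros s t Hs Ht Hst.
  pose proof (Rmin_l d e); pose proof (Rmin_r d e).
  assert (Hd' := H s t Hs Ht ltac:(lra)); assert (He' := H' s t Hs Ht ltac:(lra)); lra.
Qed.

Lemma path_value_reverse E gam v :
  path_value E gam v -> path_value E (reverse gam) (- v).
Proof.
  intros [phi [[d [Hd H]] <-]]; exists (fun t => phi (1 - t)); split.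
  - exists d; split; [exact Hd|]; intros s t Hs Ht Hst.
    apply H; try (apply unit_interval_flip; assumption).
    replace (1 - t - (1 - s)) with (- (t - s)) by ring; rewrite Rabs_Ropp; exact Hst.
  - rewrite Rminus_diag, Rminus_0_r; ring.
Qed.

(** A primitive along the concatenation restricts to primitives along its halves. *)
Lemma path_value_concat E gam eta v w x :
  gam 1 = eta 0 -> path_value E gam v -> path_value E eta w ->
  path_value E (concat gam eta) x -> x = v + w.
Proof.
  intros J Hv Hw [phi [[d [Hd H]] <-]].
  assert (V : path_value E gam (phi (1 / 2) - phi 0)).
  { exists (fun t => phi (t / 2)); split; [|unfold Rdiv; rewrite Rmult_0_l; reflexivity].
    exists d; split; [exact Hd|]; intros s t [S0 S1] [T0 T1] Hst.
    rewrite (H (s / 2) (t / 2)).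
    - rewrite !concat_left by lra; f_equal; f_equal; field.
    - split; lra.
    - split; lra.
    - replace (t / 2 - s / 2) with ((t - s) / 2) by field.
      apply Rabs_def2 in Hst; apply Rabs_def1; lra. }
  assert (W : path_value E eta (phi 1 - phi (1 / 2))).
  { exists (fun t => phi (1 / 2 + t / 2)); split.
    2: { replace (1 / 2 + 1 / 2) with 1 by field; unfold Rdiv at 2; rewrite Rmult_0_l.
         rewrite Rplus_0_r; reflexivity. }
    exists d; split; [exact Hd|]; intros s t [S0 S1] [T0 T1] Hst.
    rewrite (H (1 / 2 + s / 2) (1 / 2 + t / 2)).
    - rewrite !concat_right by (assumption || lra); f_equal; f_equal; field.
    - split; lra.
    - split; lra.
    - replace (1 / 2 + t / 2 - (1 / 2 + s / 2)) with ((t - s) / 2) by field.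
      apply Rabs_def2 in Hst; apply Rabs_def1; lra. }
  rewrite (path_value_unique _ _ _ _ Hv V), (path_value_unique _ _ _ _ Hw W); ring.
Qed.

(** Lift the contracting homotopy: the lift is constant along the three sides of the
    square that are sent to the base point, so it takes the same value at both ends
    of the fourth. *)
Lemma path_value_loop D E p gam v :
  simply_connected_domain D -> local_cocycle D E -> path_in D p p gam ->
  path_value E gam v -> v = 0.
Proof.
  intros [_ [_ [_ Hsc]]] HE Hp Hv.
  destruct (Hsc p gam Hp) as [H [HC [HD [Hbot [Htop Hside]]]]].
  destruct (lift_over_unit_square D E H HE HC HD) as [phi [d [Hd Hphi]]].
  assert (I0 : unit_interval 0) by (split; lra).
  assert (I1 : unit_interval 1) by (split; lra).
  assert (Z : Rabs 0 < d) by (rewrite Rabs_R0; exact Hd).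
  assert (Epp : E p p = 0).
  { pose proof (Hphi (0, 0) (0, 0) (conj I0 I0) (conj I0 I0)) as Q.
    rewrite (proj1 (Hside 0 I0)) in Q; rewrite <- Q; [ring|].
    apply square_center, Hd. }
  assert (L : phi (0, 1) = phi (0, 0)).
  { apply (locally_constant_on_interval (fun s => phi (0, s)) d Hd); [|exact I1].
    intros s t Hs Ht Hst; apply Rminus_diag_uniq.
    rewrite (Hphi (0, s) (0, t)); [|split; assumption..|split; simpl; [|exact Hst]].
    - rewrite (proj1 (Hside s Hs)), (proj1 (Hside t Ht)); exact Epp.
    - rewrite Rminus_diag; exact Z. }
  assert (Rt : phi (1, 1) = phi (1, 0)).
  { apply (locally_constant_on_interval (fun s => phi (1, s)) d Hd); [|exact I1].
    intros s t Hs Ht Hst; apply Rminus_diag_uniq.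
    rewrite (Hphi (1, s) (1, t)); [|split; assumption..|split; simpl; [|exact Hst]].
    - rewrite (proj2 (Hside s Hs)), (proj2 (Hside t Ht)); exact Epp.
    - rewrite Rminus_diag; exact Z. }
  assert (T : phi (1, 1) = phi (0, 1)).
  { apply (locally_constant_on_interval (fun s => phi (s, 1)) d Hd); [|exact I1].
    intros s t Hs Ht Hst; apply Rminus_diag_uniq.
    rewrite (Hphi (s, 1) (t, 1)); [|split; assumption..|split; simpl; [exact Hst|]].
    - rewrite (Htop s Hs), (Htop t Ht); exact Epp.
    - rewrite Rminus_diag; exact Z. }
  apply (path_value_unique E gam); [exact Hv|].
  exists (fun t => phi (t, 0)); split; [|lra].
  exists d; split; [exact Hd|]; intros s t Hs Ht Hst.
  rewrite (Hphi (s, 0) (t, 0)); [|split; assumption..|split; simpl; [exact Hst|]].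
  - rewrite (Hbot s Hs), (Hbot t Ht); reflexivity.
  - rewrite Rminus_diag; exact Z.
Qed.

Lemma path_value_segment E c r a b :
  cocycle_on (square c r) E -> square c r a -> square c r b ->
  path_value E (segment a b) (E a b).
Proof.
  intros HE Ha Hb; exists (fun t => E a (segment a b t)); split.
  - exists 1; split; [exact Rlt_0_1|]; intros s t Hs Ht _.
    pose proof (HE a (segment a b s) (segment a b t) Ha
      (segment_in_square _ _ _ _ _ Ha Hb Hs) (segment_in_square _ _ _ _ _ Ha Hb Ht)); lra.
  - rewrite segment_0, segment_1, (cocycle_diag _ _ _ HE Ha); ring.
Qed.

(** Integrate along any path from a base point; two paths with the same ends give
    the same value because together they form a loop. *)
Lemma cocycle_is_increment (D : C -> Prop) (E : C -> C -> R) :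
  simply_connected_domain D -> local_cocycle D E ->
  exists U : C -> R, forall z, D z -> exists r, 0 < r /\
    forall a b, square z r a -> square z r b -> U b - U a = E a b.
Proof.
  intros Hsc HE; pose proof Hsc as [Hop [[p Hp] [Hconn _]]].
  destruct (choice (fun z v => D z ->
      exists gam, path_in D p z gam /\ path_value E gam v)) as [U HU].
  { intros z; destruct (classic (D z)) as [Hz|Hz]; [|exists 0; tauto].
    destruct (Hconn p z Hp Hz) as [gam Hg].
    destruct (path_value_exists D E p z gam HE Hg) as [v Hv]; exists v; eauto. }
  exists U; intros z Hz.
  destruct (proj1 (locally_square D z) (Hop z Hz)) as [r1 [R1 S1]].
  destruct (HE z Hz) as [r2 [R2 S2]].
  assert (sub : forall w, square z (Rmin r1 r2) w -> square z r1 w /\ square z r2 w).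
  { intros w [W1 W2]; pose proof (Rmin_l r1 r2); pose proof (Rmin_r r1 r2).
    repeat split; lra. }
  exists (Rmin r1 r2); split; [apply Rmin_glb_lt; assumption|].
  intros a b Ha Hb; apply sub in Ha; apply sub in Hb.
  (* The loop: out to [a], along the segment to [b], and back along the path to [b]. *)
  destruct (HU a (S1 a (proj1 Ha))) as [ga [Pa Va]].
  destruct (HU b (S1 b (proj1 Hb))) as [gb [Pb Vb]].
  pose proof (segment_path D z r1 a b S1 (proj1 Ha) (proj1 Hb)) as Ps.
  pose proof (path_value_segment E z r2 a b S2 (proj2 Ha) (proj2 Hb)) as Vs.
  pose proof (concat_path _ _ _ _ _ _ Pa Ps) as Pas.
  destruct (path_value_exists _ _ _ _ _ HE Pas) as [v Vas].
  pose proof (reverse_path _ _ _ _ Pb) as Pr.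
  pose proof (concat_path _ _ _ _ _ _ Pas Pr) as Pl.
  destruct (path_value_exists _ _ _ _ _ HE Pl) as [l Vl].
  assert (join : forall x y w g h, path_in D x y g -> path_in D y w h -> g 1 = h 0)
    by (intros x y w g h [_ [_ [_ G]]] [_ [_ [G' _]]]; congruence).
  pose proof (path_value_loop D E p _ l Hsc HE Pl Vl) as L0.
  rewrite (path_value_concat E _ _ _ _ l (join _ _ _ _ _ Pas Pr) Vas
    (path_value_reverse _ _ _ Vb) Vl) in L0.
  rewrite (path_value_concat E _ _ _ _ v (join _ _ _ _ _ Pa Ps) Va Vs Vas) in L0.
  lra.
Qed.

(** The global potential differs by a constant from each local primitive, and so
    inherits its partial derivatives. *)
Lemma closed_form_primitive (D : C -> Prop) (A B : C -> R) :
  simply_connected_domain D -> C1_on D A -> C1_on D B ->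
  (forall z, D z -> dy A z = dx B z) ->
  exists U, has_gradient D U A B.
Proof.
  intros Hsc HA HB Hcl.
  pose proof (closed_form_local_increment D A B (proj1 Hsc) HA HB Hcl) as Hloc.
  destruct (cocycle_is_increment D (corner_integral A B) Hsc) as [U HU].
  { intros z Hz; destruct (Hloc z Hz) as [r [Hr [F [_ HF]]]].
    exists r; split; [exact Hr|]; intros a b c Ha Hb Hc; rewrite !HF by assumption; ring. }
  exists U; intros z Hz.
  destruct (Hloc z Hz) as [r1 [R1 [F [GF HF]]]].
  destruct (HU z Hz) as [r2 [R2 H2]].
  pose proof (Rmin_l r1 r2); pose proof (Rmin_r r1 r2).
  assert (R0 : 0 < Rmin r1 r2) by (apply Rmin_glb_lt; assumption).
  assert (Hz1 := square_center z r1 R1).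
  destruct (GF z Hz1) as [Gx Gy].
  assert (E : forall w, square z (Rmin r1 r2) w -> U z - F z + F w = U w).
  { intros w [W1 W2].
    assert (Q := H2 z w (square_center z r2 R2) ltac:(split; lra)).
    rewrite HF in Q; [lra | exact Hz1 | split; lra]. }
  split.
  - apply (is_derive_ext_loc (fun t => U z - F z + F (t, snd z))).
    + exists (mkposreal _ R0); intros t Ht; apply E; split; simpl; [exact Ht|].
      rewrite Rminus_diag, Rabs_R0; exact R0.
    + rewrite <- (Rplus_0_l (A z)).
      apply (is_derive_plus (fun _ => U z - F z) (fun t => F (t, snd z)));
        [apply (is_derive_const (U z - F z)) | exact Gx].
  - apply (is_derive_ext_loc (fun t => U z - F z + F (fst z, t))).
    + exists (mkposreal _ R0); intros t Ht; apply E; split; simpl; [|exact Ht].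
      rewrite Rminus_diag, Rabs_R0; exact R0.
    + rewrite <- (Rplus_0_l (B z)).
      apply (is_derive_plus (fun _ => U z - F z) (fun t => F (fst z, t)));
        [apply (is_derive_const (U z - F z)) | exact Gy].
Qed.

(** * Rectifiable curves and the line integral of a gradient *)

(** Follow the given path: the set of times whose position can be reached from [a] by
    a Lipschitz path is open and closed, since a segment can be appended inside a small
    square. *)
Lemma lipschitz_path_exists D a b gam :
  open D -> path_in D a b gam ->
  exists eta K, 0 <= K /\ path_in D a b eta /\ lipschitz_on_interval K eta.
Proof.
  intros HD [Cg [Dg [S1 E1]]].
  pose (P t := exists eta K, 0 <= K /\ path_in D a (gam t) eta /\ lipschitz_on_interval K eta).
  assert (I1 : unit_interval 1) by (split; lra).
  rewrite <- E1; apply (unit_interval_connected P); [| |exact I1].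
  - intros t Ht; destruct (proj1 (locally_square D (gam t)) (HD _ (Dg t Ht))) as [r [Hr Hs]].
    destruct (continuous_on_interval_nbhd _ _ _ _ Cg Ht Hr) as [d [Hd Hn]].
    assert (ext : forall s u, square (gam t) r (gam s) -> square (gam t) r (gam u) ->
              P s -> P u).
    { intros s u Qs Qu [eta [K [HK [Pe Le]]]].
      exists (concat eta (segment (gam s) (gam u))), (2 * (K + Cmod (gam u - gam s)%C)).
      pose proof (Cmod_ge_0 (gam u - gam s)%C).
      split; [lra|]; split.
      - apply (concat_path _ _ _ _ _ _ Pe), (segment_path D (gam t) r); assumption.
      - apply concat_lipschitz; [exact HK | assumption | exact Le | apply segment_lipschitz]. }
    exists d; split; [exact Hd|]; intros s Hs' Hst.
    pose proof (Hn s Hs' Hst); pose proof (square_center (gam t) r Hr).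
    split; apply ext; assumption.
  - unfold P; rewrite S1; exists (segment a a), (Cmod (a - a)%C).
    assert (I0 : unit_interval 0) by (split; lra).
    pose proof (Dg 0 I0) as Ha; rewrite S1 in Ha.
    destruct (proj1 (locally_square D a) (HD a Ha)) as [r [Hr Hs]].
    split; [apply Cmod_ge_0|]; split; [|apply segment_lipschitz].
    apply (segment_path D a r); [exact Hs|apply square_center, Hr..].
Qed.

Lemma lipschitz_rectifiable D a b gam K :
  0 <= K -> path_in D a b gam -> lipschitz_on_interval K gam ->
  rectifiable_curve D a b gam.
Proof.
  intros HK Hp HL; split; [exact Hp|]; exists K; intros n t Ht Hm.
  assert (Q : sum_f_R0 (fun i => Cmod (gam (t (S i)) - gam (t i))%C) n
              <= K * (t (S n) - t O)).
  { assert (one : forall i, Cmod (gam (t (S i)) - gam (t i))%C <= K * (t (S i) - t i)).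
    { intros i; rewrite <- (Rabs_pos_eq (t (S i) - t i)); [apply HL; apply Ht|].
      specialize (Hm i); lra. }
    induction n as [|n IH]; [apply one|]; simpl sum_f_R0; specialize (one (S n)); lra. }
  destruct (Ht (S n)), (Ht O); nra.
Qed.

(** The default value 1 extends a subdivision of the unit interval by repeating its
    last point, which keeps the sequence monotone and adds chords of length zero. *)
Definition knots (h : R) (l : list (R * R)) (i : nat) : R :=
  seq.nth 1 (h :: seq.unzip1 l) i.

Lemma pointed_subdiv_cons (h : R) (x : R * R) (l : list (R * R)) :
  pointed_subdiv (mkSF_seq h (x :: l)) ->
  (h <= snd x <= fst x) /\ pointed_subdiv (mkSF_seq (fst x) l).
Proof.
  intros H; split; [apply (H O); unfold SF_size; simpl; apply Nat.lt_0_succ|].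
  intros i Hi; apply (H (S i)); unfold SF_size in *; simpl in *.
  apply (proj1 (Nat.succ_lt_mono _ _)), Hi.
Qed.

Lemma knots_monotone (l : list (R * R)) (h : R) :
  pointed_subdiv (mkSF_seq h l) -> seq.last h (seq.unzip1 l) = 1 ->
  forall i, knots h l i <= knots h l (S i) /\ h <= knots h l i <= 1.
Proof.
  revert h; induction l as [|x l IH]; intros h Hp Hl i.
  - simpl in Hl; subst h; unfold knots; destruct i as [|[|i]]; simpl; lra.
  - destruct (pointed_subdiv_cons h x l Hp) as [Hx Hp']; specialize (IH (fst x) Hp' Hl).
    destruct i as [|i].
    + destruct (IH O) as [_ B]; unfold knots in *; simpl in *; lra.
    + destruct (IH i) as [A B]; unfold knots in *; simpl in *; split; [exact A | lra].
Qed.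

(** Along a fine subdivision every summand is, up to [e] times the length of its
    chord, the increment of [psi], and these increments telescope. *)
Lemma line_sum_increment (Phi : C -> C) (psi : C -> R) (gam : R -> C) (e d : R) :
  (forall s t c, unit_interval s -> unit_interval t -> unit_interval c ->
     Rabs (s - c) < d -> Rabs (t - c) < d ->
     Rabs (psi (gam t) - psi (gam s) -
        (Re (Phi (gam c)) * (Re (gam t) - Re (gam s)) +
         Im (Phi (gam c)) * (Im (gam t) - Im (gam s)))) <= e * Cmod (gam t - gam s)%C) ->
  0 < d ->
  forall (l : list (R * R)) (h : R), 0 <= h ->
  pointed_subdiv (mkSF_seq h l) -> seq.last h (seq.unzip1 l) = 1 ->
  seq_step (h :: seq.unzip1 l) < d ->
  Rabs (psi (gam 1) - psi (gam h) - line_sum Phi gam (mkSF_seq h l)) <=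
  e * sum_f_R0 (fun i => Cmod (gam (knots h l (S i)) - gam (knots h l i))%C) (seq.size l).
Proof.
  intros Hloc Hd; induction l as [|x l IH]; intros h Hh Hp Hl Hs.
  - simpl in Hl; subst h; unfold line_sum, knots; simpl.
    replace (gam 1 - gam 1)%C with (RtoC 0) by ring.
    rewrite Cmod_0, Rmult_0_r, Rminus_diag, Rminus_0_r, Rabs_R0; lra.
  - destruct (pointed_subdiv_cons h x l Hp) as [Hx Hp'].
    pose proof (knots_monotone (x :: l) h Hp Hl 1) as [_ [_ Hx1]].
    unfold knots in Hx1; simpl in Hx1.
    unfold seq_step in Hs; simpl in Hs.
    assert (Hs1 : fst x - h < d).
    { eapply Rle_lt_trans; [apply Rle_abs|]; eapply Rle_lt_trans; [apply Rmax_l | exact Hs]. }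
    assert (Hs2 : seq_step (fst x :: seq.unzip1 l) < d)
      by (eapply Rle_lt_trans; [apply Rmax_r | exact Hs]).
    assert (IH' := IH (fst x) ltac:(lra) Hp' Hl Hs2).
    assert (one := Hloc h (fst x) (snd x) ltac:(split; lra) ltac:(split; lra)
      ltac:(split; lra) ltac:(apply Rabs_def1; lra) ltac:(apply Rabs_def1; lra)).
    rewrite decomp_sum by (simpl; lia).
    replace (line_sum Phi gam (mkSF_seq h (x :: l))) with
      (Re (Phi (gam (snd x))) * (Re (gam (fst x)) - Re (gam h)) +
       Im (Phi (gam (snd x))) * (Im (gam (fst x)) - Im (gam h)) +
       line_sum Phi gam (mkSF_seq (fst x) l)).
    2: { unfold line_sum; simpl; f_equal; destruct x as [x c], l as [|y l]; reflexivity. }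
    unfold knots in *; simpl in *.
    eapply Rle_trans; [|rewrite Rmult_plus_distr_l; apply Rplus_le_compat;
                        [exact one | exact IH']].
    eapply Rle_trans; [|apply Rabs_triang]; right; f_equal; ring.
Qed.

(** Compactness of the parameter interval makes the first order approximation of
    [psi] along the curve uniform; the bound on the length sums up the errors. *)
Lemma line_integral_gradient (D : C -> Prop) (Phi : C -> C) (psi : C -> R) (a b : C) gam :
  open D -> has_gradient D psi (fun z => Re (Phi z)) (fun z => Im (Phi z)) ->
  continuous_in D (fun z => Re (Phi z)) -> continuous_in D (fun z => Im (Phi z)) ->
  rectifiable_curve D a b gam ->
  is_line_integral Phi gam (psi b - psi a).
Proof.
  intros HD Hg Hx Hy [[Cg [Dg [S1 E1]]] [L HL]].
  apply filterlim_locally; intros eps.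
  pose (e := eps / (2 * (Rabs L + 1))).
  pose proof (Rabs_pos L) as PL; pose proof (Rle_abs L) as LL.
  assert (He : 0 < e) by (apply Rdiv_lt_0_compat; [apply cond_pos | lra]).
  (* The two coordinates of a chord add up to at most twice its length, whence [2 * e]. *)
  destruct (unit_interval_lebesgue (fun S => forall s t c, S s -> S t -> S c ->
     Rabs (psi (gam t) - psi (gam s) -
        (Re (Phi (gam c)) * (Re (gam t) - Re (gam s)) +
         Im (Phi (gam c)) * (Im (gam t) - Im (gam s)))) <= 2 * e * Cmod (gam t - gam s)%C))
    as [d [Hd Hloc]].
  - intros S T HST HT s t c Ss St Sc; apply HT; auto.
  - intros t0 Ht0.
    destruct (gradient_approximation D psi _ _ (gam t0) e HD Hg Hx Hy (Dg _ Ht0) He)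
      as [r [Hr [_ Happ]]].
    destruct (continuous_on_interval_nbhd _ _ _ _ Cg Ht0 Hr) as [d [Hd Hn]].
    exists d; split; [exact Hd|]; intros s t c [Is Ds] [It Dt] [Ic Dc].
    eapply Rle_trans; [apply Happ; apply Hn; assumption|].
    pose proof (Rmax_Cmod (gam t - gam s)%C) as M.
    pose proof (Rmax_l (Rabs (fst (gam t - gam s)%C)) (Rabs (snd (gam t - gam s)%C))).
    pose proof (Rmax_r (Rabs (fst (gam t - gam s)%C)) (Rabs (snd (gam t - gam s)%C))).
    simpl in *; unfold Rminus; nra.
  - exists (mkposreal d Hd); intros [h l] Hstep [Hp [Hh Hl]].
    unfold SF_lx in Hl; simpl in Hh, Hl, Hstep.
    rewrite Rmin_left in Hh by lra; rewrite Rmax_right in Hl by lra; subst h.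
    pose proof (line_sum_increment Phi psi gam (2 * e) d) as K.
    assert (K' := K ltac:(intros s t c Is It Ic Ds Dt; apply (Hloc c Ic);
      split; try assumption; rewrite Rminus_diag, Rabs_R0; exact Hd)
      Hd l 0 ltac:(lra) Hp Hl Hstep); clear K.
    rewrite <- S1, <- E1.
    assert (S := HL (seq.size l) (knots 0 l)).
    apply Rle_lt_trans with (2 * e * Rabs L).
    - eapply Rle_trans; [|eapply Rle_trans; [exact K'|]].
      + right; change (minus ?x ?y) with (x - y).
        unfold abs; simpl; rewrite <- Rabs_Ropp; f_equal; unfold minus, plus, opp; simpl; ring.
      + apply Rmult_le_compat_l; [lra|]; eapply Rle_trans; [apply S | exact LL].
        * intros i; apply (knots_monotone l 0 Hp Hl i).
        * intros i; apply (knots_monotone l 0 Hp Hl i).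
    - unfold e; pose proof (cond_pos eps).
      replace (2 * (eps / (2 * (Rabs L + 1))) * Rabs L) with
        (eps - eps / (Rabs L + 1)) by (field; lra).
      assert (0 < eps / (Rabs L + 1)) by (apply Rdiv_lt_0_compat; lra); lra.
Qed.

(** Uniqueness of the value rests on the existence of at least one rectifiable curve
    to [z]. *)
Lemma is_Abar_gradient (D : C -> Prop) (Phi : C -> C) (psi : C -> R) (z0 z : C) :
  simply_connected_domain D ->
  has_gradient D psi (fun z => Re (Phi z)) (fun z => Im (Phi z)) ->
  continuous_in D (fun z => Re (Phi z)) -> continuous_in D (fun z => Im (Phi z)) ->
  D z0 -> D z ->
  is_Abar D z0 Phi z (2 * (psi z - psi z0)) /\
  forall v, is_Abar D z0 Phi z v -> v = 2 * (psi z - psi z0).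
Proof.
  intros [HD [_ [Hconn _]]] Hg Hx Hy Hz0 Hz; split.
  - intros gam Hgam; exists (psi z - psi z0); split; [|reflexivity].
    apply (line_integral_gradient D); assumption.
  - intros v Hv.
    destruct (Hconn z0 z Hz0 Hz) as [gam Hgam].
    destruct (lipschitz_path_exists D z0 z gam HD Hgam) as [eta [K [HK [Pe Le]]]].
    pose proof (lipschitz_rectifiable D z0 z eta K HK Pe Le) as Hrect.
    destruct (Hv eta Hrect) as [l [Hl ->]].
    pose proof (line_integral_gradient D Phi psi z0 z eta HD Hg Hx Hy Hrect) as Hl'.
    f_equal; apply (filterlim_locally_unique (V := R_NormedModule) (line_sum Phi eta) l _ Hl Hl').
Qed.

(** * The Vekua equation in real form *)

Definition real_vekua (D : C -> Prop) (f u v : C -> R) : Prop :=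
  forall z, D z ->
    dx u z - dy v z = (dx f z * u z + dy f z * v z) / f z /\
    dy u z + dx v z = (dy f z * u z - dx f z * v z) / f z.

Lemma Re_dzbar (W : C -> C) (z : C) :
  Re (dzbar W z) = (dx (fun w => Re (W w)) z - dy (fun w => Im (W w)) z) / 2.
Proof.
  unfold dzbar.
  generalize (dx (fun w => Re (W w)) z) (dx (fun w => Im (W w)) z)
    (dy (fun w => Re (W w)) z) (dy (fun w => Im (W w)) z).
  intros; simpl; field.
Qed.

Lemma Im_dzbar (W : C -> C) (z : C) :
  Im (dzbar W z) = (dy (fun w => Re (W w)) z + dx (fun w => Im (W w)) z) / 2.
Proof.
  unfold dzbar.
  generalize (dx (fun w => Re (W w)) z) (dx (fun w => Im (W w)) z)
    (dy (fun w => Re (W w)) z) (dy (fun w => Im (W w)) z).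
  intros; simpl; field.
Qed.

Lemma Re_div_R (w : C) (r : R) : r <> 0 -> Re (w / RtoC r) = Re w / r.
Proof. intros Hr; destruct w; unfold Cdiv, Re, Im; simpl; field; exact Hr. Qed.

Lemma Im_div_R (w : C) (r : R) : r <> 0 -> Im (w / RtoC r) = Im w / r.
Proof. intros Hr; destruct w; unfold Cdiv, Re, Im; simpl; field; exact Hr. Qed.

Lemma C_ext (w w' : C) : Re w = Re w' -> Im w = Im w' -> w = w'.
Proof. apply injective_projections. Qed.

Lemma vekua_coefficient (f : C -> R) (z w : C) :
  f z <> 0 ->
  Re (dzbar (fun w => RtoC (f w)) z / RtoC (f z) * Cconj w) =
    (dx f z * Re w + dy f z * Im w) / f z / 2 /\
  Im (dzbar (fun w => RtoC (f w)) z / RtoC (f z) * Cconj w) =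
    (dy f z * Re w - dx f z * Im w) / f z / 2.
Proof.
  intros Hf.
  pose proof (Re_dzbar (fun w => RtoC (f w)) z) as Hr; pose proof (Im_dzbar (fun w => RtoC (f w)) z) as Hi.
  cbv beta in Hr, Hi.
  rewrite (Derive_const 0 (Im z) : dy (fun w => Im (RtoC (f w))) z = 0) in Hr.
  rewrite (Derive_const 0 (Re z) : dx (fun w => Im (RtoC (f w))) z = 0) in Hi.
  change (fun w : C => Re (RtoC (f w))) with (fun w => f w) in Hr, Hi.
  set (d := dzbar (fun w => RtoC (f w)) z) in *.
  assert (M : forall p : C, Re (p * Cconj w) = Re p * Re w + Im p * Im w /\
                 Im (p * Cconj w) = Im p * Re w - Re p * Im w)
    by (intros p; unfold Re, Im; simpl; split; ring).
  destruct (M (d / RtoC (f z))%C) as [-> ->].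
  rewrite Re_div_R, Im_div_R, Hr, Hi by exact Hf.
  change (fun w => f w) with f.
  split; field; exact Hf.
Qed.

Lemma vekua_solution_real (D : C -> Prop) (f : C -> R) (W : C -> C) :
  (forall z, D z -> f z <> 0) ->
  vekua_solution D f W <->
  C1_on D (fun z => Re (W z)) /\ C1_on D (fun z => Im (W z)) /\
  real_vekua D f (fun z => Re (W z)) (fun z => Im (W z)).
Proof.
  intros Hf; split; intros [H1 [H2 H]]; split; [exact H1 | split; [exact H2|] | exact H1 |
    split; [exact H2|]]; intros z Hz; specialize (H z Hz);
    destruct (vekua_coefficient f z (W z) (Hf z Hz)) as [Kr Ki].
  - rewrite <- H, Re_dzbar in Kr; rewrite <- H, Im_dzbar in Ki; split; lra.
  - apply C_ext; [rewrite Kr, Re_dzbar | rewrite Ki, Im_dzbar]; f_equal; apply H.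
Qed.

Lemma C1_on_minus D u v : open D -> C1_on D u -> C1_on D v -> C1_on D (fun z => u z - v z).
Proof.
  intros HD Hu Hv.
  destruct (C1_on_gradient D u Hu) as [Gu [Cux Cuy]].
  destruct (C1_on_gradient D v Hv) as [Gv [Cvx Cvy]].
  apply (gradient_C1_on D _ _ _ HD (has_gradient_minus _ _ _ _ _ _ _ Gu Gv));
    apply continuous_in_minus; assumption.
Qed.

Lemma C1_on_continuous D u : open D -> C1_on D u -> continuous_in D u.
Proof.
  intros HD Hu; destruct (C1_on_gradient D u Hu) as [Gu [Cux Cuy]].
  exact (continuous_in_gradient _ _ _ _ HD Gu Cux Cuy).
Qed.

Lemma C1_on_mult D u v : open D -> C1_on D u -> C1_on D v -> C1_on D (fun z => u z * v z).
Proof.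
  intros HD Hu Hv.
  destruct (C1_on_gradient D u Hu) as [Gu [Cux Cuy]].
  destruct (C1_on_gradient D v Hv) as [Gv [Cvx Cvy]].
  pose proof (C1_on_continuous D u HD Hu); pose proof (C1_on_continuous D v HD Hv).
  apply (gradient_C1_on D _ _ _ HD (has_gradient_mult _ _ _ _ _ _ _ Gu Gv));
    apply continuous_in_plus; apply continuous_in_mult; assumption.
Qed.

Lemma C1_on_plus D u v : open D -> C1_on D u -> C1_on D v -> C1_on D (fun z => u z + v z).
Proof.
  intros HD Hu Hv.
  destruct (C1_on_gradient D u Hu) as [Gu [Cux Cuy]].
  destruct (C1_on_gradient D v Hv) as [Gv [Cvx Cvy]].
  apply (gradient_C1_on D _ _ _ HD (has_gradient_plus _ _ _ _ _ _ _ Gu Gv));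
    apply continuous_in_plus; assumption.
Qed.

Lemma C1_on_div D u v : open D -> (forall z, D z -> v z <> 0) ->
  C1_on D u -> C1_on D v -> C1_on D (fun z => u z / v z).
Proof.
  intros HD Hn Hu Hv.
  destruct (C1_on_gradient D u Hu) as [Gu [Cux Cuy]].
  destruct (C1_on_gradient D v Hv) as [Gv [Cvx Cvy]].
  pose proof (C1_on_continuous D u HD Hu); pose proof (C1_on_continuous D v HD Hv).
  assert (Cv2 : continuous_in D (fun z => v z ^ 2)).
  { apply (continuous_in_mult D v); [assumption|].
    apply (continuous_in_mult D v); [assumption|intros z _; apply continuous_const]. }
  assert (Hn2 : forall z, D z -> v z ^ 2 <> 0) by (intros z Hz; apply pow_nonzero, Hn, Hz).
  apply (gradient_C1_on D _ _ _ HD (has_gradient_div _ _ _ _ _ _ _ Hn Gu Gv));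
    (apply continuous_in_div; [exact Hn2| |exact Cv2]);
    apply continuous_in_minus; apply continuous_in_mult; assumption.
Qed.

(** * The transplant form *)

(** The components of [f grad (g / f)].  Written this way they contain no derivative
    of a quotient, and they vanish when [g] is a multiple of [f]. *)
Definition twist_x (f g : C -> R) (z : C) : R := dx g z - g z / f z * dx f z.
Definition twist_y (f g : C -> R) (z : C) : R := dy g z - g z / f z * dy f z.

(** The coefficients of [Im W k + Re W k'] where [k] is the field [f grad (g / f)] and
    [k'] is [k] rotated by a right angle. *)
Definition form_x (f g : C -> R) (W : C -> C) (z : C) : R :=
  Im (W z) * twist_x f g z - Re (W z) * twist_y f g z.
Definition form_y (f g : C -> R) (W : C -> C) (z : C) : R :=
  Im (W z) * twist_y f g z + Re (W z) * twist_x f g z.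

Lemma C1_on_twist (D : C -> Prop) (f g : C -> R) :
  open D -> C2_on D f -> C2_on D g -> (forall z, D z -> f z <> 0) ->
  C1_on D (twist_x f g) /\ C1_on D (twist_y f g).
Proof.
  intros HD [Hf [Hfx Hfy]] [Hg [Hgx Hgy]] Hn.
  pose proof (C1_on_div D g f HD Hn Hg Hf) as Hh.
  split; apply C1_on_minus; try assumption; apply C1_on_mult; assumption.
Qed.

Lemma C1_on_form (D : C -> Prop) (f g : C -> R) (W : C -> C) :
  open D -> C2_on D f -> C2_on D g -> (forall z, D z -> f z <> 0) ->
  vekua_solution D f W ->
  C1_on D (form_x f g W) /\ C1_on D (form_y f g W).
Proof.
  intros HD Hf Hg Hn [Hu [Hv _]].
  destruct (C1_on_twist D f g HD Hf Hg Hn) as [Kx Ky].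
  split; [apply C1_on_minus | apply C1_on_plus]; try apply C1_on_mult; assumption.
Qed.

(** After the equations for [W] are used to eliminate the derivatives of [Re W], the
    derivatives of [Im W] cancel.  What is left of second order is the curl and the
    divergence of [f grad (g / f)]; the former needs equality of mixed derivatives and
    the latter the two Schroedinger equations. *)
Lemma form_closed (D : C -> Prop) (q f g : C -> R) (W : C -> C) :
  open D -> C2_on D f -> C2_on D g -> (forall z, D z -> f z <> 0) ->
  schrodinger_solution D q f -> schrodinger_solution D q g ->
  vekua_solution D f W ->
  forall z, D z -> dy (form_x f g W) z = dx (form_y f g W) z.
Proof.
  intros HD Hf2 Hg2 Hn Sf Sg HW z Hz.
  destruct (proj1 (vekua_solution_real D f W Hn) HW) as [Hu [Hv HV]].
  pose proof (mixed_derivatives D f z HD Hf2 Hz) as Mf.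
  pose proof (mixed_derivatives D g z HD Hg2 Hz) as Mg.
  destruct Hf2 as [Hf [Hfx Hfy]], Hg2 as [Hg [Hgx Hgy]].
  apply C1_on_gradient in Hu; apply C1_on_gradient in Hv.
  apply C1_on_gradient in Hf; apply C1_on_gradient in Hg.
  apply C1_on_gradient in Hfx; apply C1_on_gradient in Hfy.
  apply C1_on_gradient in Hgx; apply C1_on_gradient in Hgy.
  pose proof (has_gradient_div D _ _ _ _ _ _ Hn (proj1 Hg) (proj1 Hf)) as Gh.
  pose proof (has_gradient_minus D _ _ _ _ _ _ (proj1 Hgx)
    (has_gradient_mult D _ _ _ _ _ _ Gh (proj1 Hfx))) as Gkx.
  pose proof (has_gradient_minus D _ _ _ _ _ _ (proj1 Hgy)
    (has_gradient_mult D _ _ _ _ _ _ Gh (proj1 Hfy))) as Gky.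
  pose proof (has_gradient_minus D _ _ _ _ _ _
    (has_gradient_mult D _ _ _ _ _ _ (proj1 Hv) Gkx)
    (has_gradient_mult D _ _ _ _ _ _ (proj1 Hu) Gky)) as GA.
  pose proof (has_gradient_plus D _ _ _ _ _ _
    (has_gradient_mult D _ _ _ _ _ _ (proj1 Hv) Gky)
    (has_gradient_mult D _ _ _ _ _ _ (proj1 Hu) Gkx)) as GB.
  transitivity (dy (fun z => Im (W z) * (dx g z - g z / f z * dx f z) -
                             Re (W z) * (dy g z - g z / f z * dy f z)) z); [reflexivity|].
  transitivity (dx (fun z => Im (W z) * (dy g z - g z / f z * dy f z) +
                             Re (W z) * (dx g z - g z / f z * dx f z)) z); [|reflexivity].
  rewrite (has_gradient_dy _ _ _ _ z GA Hz), (has_gradient_dx _ _ _ _ z GB Hz).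
  destruct (HV z Hz) as [V1 V2].
  specialize (Sf z Hz); specialize (Sg z Hz); unfold laplacian in Sf, Sg.
  specialize (Hn z Hz).
  set (u := Re (W z)) in *; set (v := Im (W z)) in *.
  set (ux := dx (fun z => Re (W z)) z) in *; set (uy := dy (fun z => Re (W z)) z) in *.
  set (vx := dx (fun z => Im (W z)) z) in *; set (vy := dy (fun z => Im (W z)) z) in *.
  assert (E1 : ux = vy + (dx f z * u + dy f z * v) / f z) by lra.
  assert (E2 : uy = - vx + (dy f z * u - dx f z * v) / f z) by lra.
  assert (E3 : dy (dy f) z = q z * f z - dx (dx f) z) by lra.
  assert (E4 : dy (dy g) z = q z * g z - dx (dx g) z) by lra.
  rewrite E1, E2, E3, E4, Mf, Mg; field; exact Hn.
Qed.

Lemma continuous_in_ext (D : C -> Prop) (u v : C -> R) :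
  open D -> (forall z, D z -> u z = v z) -> continuous_in D u -> continuous_in D v.
Proof.
  intros HD E H z Hz; apply (continuous_ext_loc _ u); [|exact (H z Hz)].
  apply (filter_imp D); [exact E | exact (HD z Hz)].
Qed.

(** The density is [g^2 grad (Re W / g) / 2] rotated by a right angle. *)
Lemma transplant_density_components (D : C -> Prop) (g : C -> R) (W : C -> C) (z : C) :
  open D -> (forall z, D z -> g z <> 0) -> C1_on D g -> C1_on D (fun z => Re (W z)) ->
  D z ->
  Re (transplant_density g W z) =
    (dy g z * Re (W z) - g z * dy (fun w => Re (W w)) z) / 2 /\
  Im (transplant_density g W z) =
    (g z * dx (fun w => Re (W w)) z - dx g z * Re (W z)) / 2.
Proof.
  intros HD Hn Hg Hu Hz.
  pose (w := fun w => (/ RtoC (g w) * Defs.Pplus W w)%C).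
  assert (Ew : forall x, D x -> Re (w x) = Re (W x) / g x /\ Im (w x) = 0).
  { intros x Hx; specialize (Hn x Hx); unfold w, Defs.Pplus, Re, Im; simpl; split; field; exact Hn. }
  assert (Gr := has_gradient_div D _ _ _ _ _ _ Hn (proj1 (C1_on_gradient D _ Hu))
                  (proj1 (C1_on_gradient D _ Hg))).
  apply (has_gradient_ext_loc D _ (fun x => Re (w x))) in Gr;
    [|exact HD | intros x Hx; symmetry; apply (Ew x Hx)].
  assert (Gi := has_gradient_const D 0).
  apply (has_gradient_ext_loc D _ (fun x => Im (w x))) in Gi;
    [|exact HD | intros x Hx; symmetry; apply (Ew x Hx)].
  pose proof (Re_dzbar w z) as Hr; pose proof (Im_dzbar w z) as Hi.
  rewrite (has_gradient_dx _ _ _ _ z Gr Hz), (has_gradient_dy _ _ _ _ z Gi Hz) in Hr.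
  rewrite (has_gradient_dx _ _ _ _ z Gi Hz), (has_gradient_dy _ _ _ _ z Gr Hz) in Hi.
  assert (M : forall p : C, Re (Ci * RtoC (g z) ^ 2 * p) = - (g z ^ 2 * Im p) /\
                            Im (Ci * RtoC (g z) ^ 2 * p) = g z ^ 2 * Re p)
    by (intros p; unfold Re, Im; simpl; split; ring).
  specialize (Hn z Hz); unfold transplant_density; fold w.
  destruct (M (dzbar w z)) as [-> ->]; rewrite Hr, Hi; split; field; exact Hn.
Qed.

Definition density_potential (g U : C -> R) (W : C -> C) (z : C) : R :=
  (g z * Im (W z) - U z) / 2.

(** The equations for [W] express the rotated derivatives of [Re W] through those of
    [Im W]; substituting them turns the density into half of the gradient of [g Im W]
    minus half of the form, the derivatives of [f] cancelling. *)
Lemma density_potential_gradient (D : C -> Prop) (f g U : C -> R) (W : C -> C) :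
  open D -> C1_on D g -> (forall z, D z -> f z <> 0) -> (forall z, D z -> g z <> 0) ->
  vekua_solution D f W -> has_gradient D U (form_x f g W) (form_y f g W) ->
  has_gradient D (density_potential g U W)
    (fun z => Re (transplant_density g W z)) (fun z => Im (transplant_density g W z)).
Proof.
  intros HD Hg Hf Hgn HW HU.
  destruct (proj1 (vekua_solution_real D f W Hf) HW) as [Hu [Hv HV]].
  assert (two : forall z : C, D z -> (fun _ => 2) z <> 0) by (intros; lra).
  assert (G := has_gradient_div D _ _ _ _ _ _ two
    (has_gradient_minus D _ _ _ _ _ _
      (has_gradient_mult D _ _ _ _ _ _ (proj1 (C1_on_gradient D _ Hg))
         (proj1 (C1_on_gradient D _ Hv))) HU) (has_gradient_const D 2)).
  eapply has_gradient_eq; [| |exact G]; intros z Hz; cbv beta;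
    destruct (transplant_density_components D g W z HD Hgn Hg Hu Hz) as [Er Ei];
    [rewrite Er | rewrite Ei]; destruct (HV z Hz) as [V1 V2]; specialize (Hf z Hz);
    unfold form_x, form_y, twist_x, twist_y.
  - replace (dy (fun w => Re (W w)) z) with
      (- dx (fun w => Im (W w)) z + (dy f z * Re (W z) - dx f z * Im (W z)) / f z) by lra.
    field; exact Hf.
  - replace (dx (fun w => Re (W w)) z) with
      (dy (fun w => Im (W w)) z + (dx f z * Re (W z) + dy f z * Im (W z)) / f z) by lra.
    field; exact Hf.
Qed.

Lemma continuous_in_density (D : C -> Prop) (g : C -> R) (W : C -> C) :
  open D -> (forall z, D z -> g z <> 0) -> C1_on D g -> C1_on D (fun z => Re (W z)) ->
  continuous_in D (fun z => Re (transplant_density g W z)) /\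
  continuous_in D (fun z => Im (transplant_density g W z)).
Proof.
  intros HD Hn Hg Hu.
  pose proof (C1_on_continuous D _ HD Hg) as Cg; pose proof (C1_on_continuous D _ HD Hu) as Cu.
  destruct (C1_on_gradient D g Hg) as [_ [Cgx Cgy]].
  destruct (C1_on_gradient D _ Hu) as [_ [Cux Cuy]].
  assert (C2 : continuous_in D (fun _ => 2)) by (intros z _; apply continuous_const).
  assert (two : forall z : C, D z -> (fun _ => 2) z <> 0) by (intros; lra).
  split.
  - eapply continuous_in_ext; [exact HD | intros z Hz; symmetry;
      apply (transplant_density_components D g W z HD Hn Hg Hu Hz)|].
    apply (continuous_in_div D _ _ two); [|exact C2].
    apply continuous_in_minus; apply continuous_in_mult; assumption.
  - eapply continuous_in_ext; [exact HD | intros z Hz; symmetry;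
      apply (transplant_density_components D g W z HD Hn Hg Hu Hz)|].
    apply (continuous_in_div D _ _ two); [|exact C2].
    apply continuous_in_minus; apply continuous_in_mult; assumption.
Qed.

(** * Behaviour at the centre *)

Definition asymptotic_power (n : nat) (a z0 : C) (Z : C -> C) : Prop :=
  filterlim (fun z : C => (Z z / (a * Cpow (z - z0) n))%C)
    (locally' z0) (locally (RtoC 1 : C)).

Lemma Cmod_le_parts (w : C) : Cmod w <= Rabs (fst w) + Rabs (snd w).
Proof.
  destruct w as [x y].
  replace (x, y) with (RtoC x + Ci * RtoC y)%C by (apply C_ext; simpl; ring).
  eapply Rle_trans; [apply Cmod_triangle|].
  rewrite Cmod_mult, Cmod_Ci, !Cmod_R; simpl.
  right; f_equal; [f_equal; ring | rewrite Rmult_1_l; f_equal; ring].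
Qed.

Lemma parts_le_Cmod (w : C) : Rabs (fst w) <= Cmod w /\ Rabs (snd w) <= Cmod w.
Proof.
  pose proof (Rmax_Cmod w); pose proof (Rmax_l (Rabs (fst w)) (Rabs (snd w)));
    pose proof (Rmax_r (Rabs (fst w)) (Rabs (snd w))); lra.
Qed.

Lemma monomial_neq_0 (a z z0 : C) (n : nat) :
  a <> RtoC 0 -> z <> z0 -> (a * (z - z0) ^ n)%C <> RtoC 0.
Proof.
  intros Ha Hz; apply Cmult_neq_0; [exact Ha|]; apply Cpow_nz.
  intros E; apply Hz; apply (f_equal (fun w => (w + z0)%C)) in E; ring_simplify in E; exact E.
Qed.

Lemma asymptotic_power_bound (n : nat) (a z0 : C) (Z : C -> C) :
  a <> RtoC 0 -> asymptotic_power n a z0 Z ->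
  exists r, 0 < r /\ forall z, square z0 r z -> z <> z0 ->
    Cmod (Z z) <= 2 * Cmod a * Cmod (z - z0)%C ^ n.
Proof.
  intros Ha HZ.
  assert (h : 0 < 1 / 2) by lra.
  assert (L := proj1 (filterlim_locally _ _) HZ (mkposreal _ h)).
  apply locally_square in L; destruct L as [r [Hr L]].
  exists r; split; [exact Hr|]; intros z Hz Hne.
  destruct (L z Hz Hne) as [B1 B2].
  pose proof (monomial_neq_0 a z z0 n Ha Hne) as Hm.
  set (m := (a * (z - z0) ^ n)%C) in *.
  replace (Z z) with ((Z z / m) * m)%C by (field; exact Hm).
  replace (2 * Cmod a * Cmod (z - z0)%C ^ n) with (2 * Cmod m)
    by (unfold m; rewrite Cmod_mult, Cmod_pow; ring).
  rewrite Cmod_mult; apply Rmult_le_compat_r; [apply Cmod_ge_0|].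
  set (w := (Z z / m)%C) in *.
  replace w with (1 + (w - 1))%C by ring.
  eapply Rle_trans; [apply Cmod_triangle|]; rewrite Cmod_1.
  pose proof (Cmod_le_parts (w - 1)%C) as P.
  change (Cmod (w - 1)%C <= Rabs (fst w - 1) + Rabs (snd w - 0)) in P.
  change (Rabs (fst w - 1) < 1 / 2) in B1; change (Rabs (snd w - 0) < 1 / 2) in B2.
  lra.
Qed.

(** The limit excludes the centre itself; continuity transfers the bound to it,
    and since the exponent is positive the bound tends to zero. *)
Lemma asymptotic_power_center (n : nat) (a z0 : C) (Z : C -> C) :
  a <> RtoC 0 -> (1 <= n)%nat -> asymptotic_power n a z0 Z ->
  continuous (fun z => Re (Z z)) z0 -> continuous (fun z => Im (Z z)) z0 ->
  Z z0 = RtoC 0.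
Proof.
  intros Ha Hn HZ Cr Ci.
  destruct (asymptotic_power_bound n a z0 Z Ha HZ) as [r [Hr HB]].
  assert (small : forall h : C -> R, continuous h z0 -> (forall z, Rabs (h z) <= Cmod (Z z)) ->
            h z0 = 0).
  { intros h Ch Hh; apply cond_eq; intros e He; rewrite Rminus_0_r.
    assert (He2 : 0 < e / 2) by lra.
    destruct (proj1 (continuous_square h z0) Ch _ He2) as [r1 [Hr1 H1]].
    pose proof (Cmod_ge_0 a) as Pa.
    (* With [|z - z0| = t < e / k] the bound [2 |a| t ^ n] is below [e / 2]. *)
    pose (k := 4 * (Cmod a + 1)).
    assert (Hk : 0 < k) by (unfold k; lra).
    pose (t := Rmin (Rmin r r1) (Rmin 1 (e / k)) / 2).
    assert (Ht : 0 < t /\ t < r /\ t < r1 /\ t < 1 /\ t < e / k).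
    { assert (0 < e / k) by (apply Rdiv_lt_0_compat; assumption).
      unfold t, Rmin; repeat destruct Rle_dec; lra. }
    clearbody t.
    pose (z := (z0 + RtoC t)%C).
    assert (Ez : (z - z0)%C = RtoC t) by (unfold z; ring).
    assert (Sz : forall r', t < r' -> square z0 r' z).
    { intros r' Hr'; split; simpl.
      - replace (fst z0 + t - fst z0) with t by ring; rewrite Rabs_pos_eq; lra.
      - replace (snd z0 + 0 - snd z0) with 0 by ring; rewrite Rabs_R0; lra. }
    assert (Hz : z <> z0).
    { intros E; assert (Q : RtoC t = RtoC 0) by (rewrite <- Ez, E; ring).
      apply RtoC_inj in Q; lra. }
    pose proof (HB z (Sz r ltac:(tauto)) Hz) as B; rewrite Ez, Cmod_R in B.
    rewrite (Rabs_pos_eq t) in B by lra.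
    assert (Pt : t ^ n <= t).
    { destruct n as [|m]; [lia|]; simpl.
      apply Rle_trans with (t * 1); [apply Rmult_le_compat_l; [lra|] | lra].
      rewrite <- (pow1 m); apply pow_incr; lra. }
    assert (Q : 2 * Cmod a * t ^ n < e / 2).
    { apply Rle_lt_trans with (2 * Cmod a * t); [apply Rmult_le_compat_l; lra|].
      assert (E : e / 2 = 2 * (Cmod a + 1) * (e / k)) by (unfold k; field; lra).
      rewrite E; nra. }
    pose proof (H1 z (Sz r1 ltac:(tauto))) as C1; pose proof (Hh z) as C2.
    rewrite Rabs_minus_sym in C1.
    replace (h z0) with ((h z0 - h z) + h z) by ring.
    eapply Rle_lt_trans; [apply Rabs_triang|]; lra. }
  apply C_ext; simpl.
  - apply (small (fun z => Re (Z z)) Cr); intros z; apply parts_le_Cmod.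
  - apply (small (fun z => Im (Z z)) Ci); intros z; apply parts_le_Cmod.
Qed.

(** A perturbation of order [n + 1] is negligible against the monomial of degree
    [n]. *)
Lemma asymptotic_power_perturb (n : nat) (a z0 : C) (Z Z' : C -> C) (M r : R) :
  a <> RtoC 0 -> asymptotic_power n a z0 Z -> 0 < r ->
  (forall z, square z0 r z -> Cmod (Z' z - Z z)%C <= M * Cmod (z - z0)%C ^ S n) ->
  asymptotic_power n a z0 Z'.
Proof.
  intros Ha HZ Hr HM; apply filterlim_locally; intros e.
  assert (he : 0 < e / 2) by (pose proof (cond_pos e); lra).
  assert (L := proj1 (filterlim_locally _ _) HZ (mkposreal _ he)).
  apply locally_square in L; destruct L as [r1 [Hr1 L]].
  assert (Pa : 0 < Cmod a) by (apply Cmod_gt_0, Ha).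
  pose (k := 2 * (Rabs M + 1) / Cmod a).
  pose proof (Rabs_pos M) as PM; pose proof (Rle_abs M) as LM.
  assert (Hk : 0 < k) by (unfold k; apply Rdiv_lt_0_compat; lra).
  pose (r2 := e / 2 / k).
  assert (Hr2 : 0 < r2) by (apply Rdiv_lt_0_compat; assumption).
  apply locally_square; exists (Rmin r (Rmin r1 r2)); split.
  { repeat apply Rmin_glb_lt; assumption. }
  intros z Hz Hne.
  assert (sub : forall s, Rmin r (Rmin r1 r2) <= s -> square z0 s z)
    by (intros s Hs; destruct Hz; split; lra).
  pose proof (Rmin_l r (Rmin r1 r2)); pose proof (Rmin_r r (Rmin r1 r2)).
  pose proof (Rmin_l r1 r2); pose proof (Rmin_r r1 r2).
  destruct (L z (sub r1 ltac:(lra)) Hne) as [B1 B2].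
  pose proof (HM z (sub r ltac:(lra))) as B3.
  destruct (sub r2 ltac:(lra)) as [S1 S2].
  pose proof (monomial_neq_0 a z z0 n Ha Hne) as Hm.
  assert (Em : Cmod (a * (z - z0) ^ n)%C = Cmod a * Cmod (z - z0)%C ^ n)
    by (rewrite Cmod_mult, Cmod_pow; reflexivity).
  pose proof (Cmod_gt_0 (a * (z - z0) ^ n)%C) as [Pm _]; specialize (Pm Hm).
  set (m := (a * (z - z0) ^ n)%C) in *.
  assert (Ew : (Z' z / m)%C = (Z z / m + (Z' z - Z z) / m)%C) by (field; exact Hm).
  assert (Bw : Cmod ((Z' z - Z z) / m)%C < e / 2).
  { rewrite Cmod_div by exact Hm.
    apply Rmult_lt_reg_r with (Cmod m); [exact Pm|].
    unfold Rdiv at 1; rewrite Rmult_assoc, Rinv_l, Rmult_1_r by lra.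
    eapply Rle_lt_trans; [exact B3|].
    pose proof (Cmod_le_parts (z - z0)%C) as P; simpl in P.
    assert (P' : Cmod (z - z0)%C < 2 * r2) by (unfold Rminus in *; lra).
    rewrite Em; simpl; set (c := Cmod (z - z0)%C) in *.
    assert (Pc : 0 < c ^ n) by (rewrite Em in Pm; nra).
    replace (M * (c * c ^ n)) with ((M * c) * c ^ n) by ring.
    rewrite <- Rmult_assoc; apply Rmult_lt_compat_r; [exact Pc|].
    assert (P0 : 0 <= c) by apply Cmod_ge_0.
    assert (E : e / 2 * Cmod a = (Rabs M + 1) * (2 * r2))
      by (unfold r2, k; field; lra).
    rewrite E; nra. }
  destruct (parts_le_Cmod ((Z' z - Z z) / m)%C) as [Q1 Q2].
  rewrite Ew; set (p := (Z z / m)%C) in *; set (s := ((Z' z - Z z) / m)%C) in *.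
  change (Rabs (fst p - 1) < e / 2) in B1; change (Rabs (snd p - 0) < e / 2) in B2.
  assert (T1 : Rabs (fst s) < e / 2) by lra; assert (T2 : Rabs (snd s) < e / 2) by lra.
  apply Rabs_def2 in B1; apply Rabs_def2 in B2; apply Rabs_def2 in T1; apply Rabs_def2 in T2.
  split; [change (Rabs (fst p + fst s - 1) < e) | change (Rabs (snd p + snd s - 0) < e)];
    apply Rabs_def1; lra.
Qed.

Lemma Cmod_le_coordinates (w w' : C) :
  Rabs (fst w) <= Rabs (fst w') -> Rabs (snd w) <= Rabs (snd w') -> Cmod w <= Cmod w'.
Proof.
  intros H1 H2; apply sqrt_le_1_alt; apply Rplus_le_compat;
    rewrite <- !Rsqr_pow2; apply Rsqr_le_abs_1; assumption.
Qed.

(** Every point of the right angle from [z0] to [z] is at most as far from [z0] as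
    [z] is, so the bound on the partial derivatives at [z] serves for the whole path. *)
Lemma primitive_order (D : C -> Prop) (U A B : C -> R) (z0 : C) (n : nat) (M r : R) :
  has_gradient D U A B -> 0 <= M ->
  (forall w, square z0 r w -> D w /\ Rabs (A w) <= M * Cmod (w - z0)%C ^ n /\
                              Rabs (B w) <= M * Cmod (w - z0)%C ^ n) ->
  forall z, square z0 r z -> Rabs (U z - U z0) <= 2 * M * Cmod (z - z0)%C ^ S n.
Proof.
  intros HU HM Hb z Hz.
  assert (Hr : 0 < r) by (destruct Hz as [H1 _]; pose proof (Rabs_pos (fst z - fst z0)); lra).
  set (c := Cmod (z - z0)%C).
  assert (P0 : 0 <= c) by apply Cmod_ge_0.
  assert (K := corner_mvt D U A B z0 z 0 0 (M * c ^ n) HU).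
  eapply Rle_trans; [|eapply Rle_trans; [apply K|]].
  - right; f_equal; ring.
  - intros w Hw.
    destruct (Hb w (square_corner z0 r z0 z w (square_center z0 r Hr) Hz Hw)) as [HD [HA HB]].
    assert (Hc : Cmod (w - z0)%C ^ n <= c ^ n).
    { apply pow_incr; split; [apply Cmod_ge_0|].
      unfold c; apply Cmod_le_coordinates; simpl; fold (Rminus (fst w) (fst z0));
        fold (Rminus (snd w) (snd z0)); fold (Rminus (fst z) (fst z0));
        fold (Rminus (snd z) (snd z0)).
      - destruct Hw as [[Hw _]|[Hw _]]; [|right; congruence].
        revert Hw; unfold Rmin, Rmax; destruct Rle_dec; unfold Rabs;
          repeat destruct Rcase_abs; lra.
      - destruct Hw as [[_ Hw]|[_ Hw]].
        + rewrite Hw, Rminus_diag, Rabs_R0; apply Rabs_pos.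
        + revert Hw; unfold Rmin, Rmax; destruct Rle_dec; unfold Rabs;
            repeat destruct Rcase_abs; lra. }
    rewrite !Rminus_0_r; split; [exact HD|].
    assert (M * Cmod (w - z0)%C ^ n <= M * c ^ n) by (apply Rmult_le_compat_l; assumption).
    lra.
  - destruct (parts_le_Cmod (z - z0)%C) as [Q1 Q2]; fold c in Q1, Q2; simpl in Q1, Q2.
    assert (0 <= M * c ^ n) by (apply Rmult_le_pos; [exact HM | apply pow_le, P0]).
    simpl pow; replace (2 * M * (c * c ^ n)) with (M * c ^ n * (c + c)) by ring.
    apply Rmult_le_compat_l; [assumption|]; unfold Rminus; lra.
Qed.

Lemma transplant_parts (D : C -> Prop) (z0 : C) (g : C -> R) (W : C -> C) (z : C) :
  g z <> 0 ->
  Re (transplant D z0 g W z) = Re (W z) /\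
  Im (transplant D z0 g W z) = Abar D z0 (transplant_density g W) z / g z.
Proof.
  intros Hg; unfold transplant, Pplus.
  generalize (Abar D z0 (transplant_density g W) z); intros v.
  generalize (W z); intros [x y]; unfold Re, Im; simpl; split; field; exact Hg.
Qed.

(** The real part is untouched, and the new imaginary part is
    [2 (psi - psi z0) / g] for a potential [psi] of the density.  The two equations
    can then be read off from the definition of the density. *)
Lemma transplant_vekua (D : C -> Prop) (g psi : C -> R) (z0 : C) (W : C -> C) :
  open D -> C1_on D g -> (forall z, D z -> g z <> 0) ->
  C1_on D (fun z => Re (W z)) ->
  has_gradient D psi (fun z => Re (transplant_density g W z))
                     (fun z => Im (transplant_density g W z)) ->
  (forall z, D z -> Abar D z0 (transplant_density g W) z = 2 * (psi z - psi z0)) ->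
  vekua_solution D g (transplant D z0 g W).
Proof.
  intros HD Hg Hn Hu Hpsi HA.
  apply (vekua_solution_real D g _ Hn).
  destruct (C1_on_gradient D g Hg) as [Gg [Cgx Cgy]].
  destruct (C1_on_gradient D _ Hu) as [Gu [Cux Cuy]].
  destruct (continuous_in_density D g W HD Hn Hg Hu) as [Cr Ci].
  assert (Hpsi1 : C1_on D psi) by exact (gradient_C1_on D psi _ _ HD Hpsi Cr Ci).
  assert (Hc : forall k, C1_on D (fun _ => k)).
  { intros k; apply (gradient_C1_on D _ _ _ HD (has_gradient_const D k));
      intros z _; apply continuous_const. }
  pose (v := fun z => 2 * (psi z - psi z0) / g z).
  assert (Hv : C1_on D v).
  { apply (C1_on_div D (fun z => 2 * (psi z - psi z0)) g HD Hn); [|exact Hg].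
    apply (C1_on_mult D (fun _ => 2) _ HD (Hc 2)).
    apply (C1_on_minus D _ _ HD Hpsi1 (Hc (psi z0))). }
  assert (Eu : forall z, D z -> Re (W z) = Re (transplant D z0 g W z)).
  { intros z Hz; symmetry; apply transplant_parts, Hn, Hz. }
  assert (Ev : forall z, D z -> v z = Im (transplant D z0 g W z)).
  { intros z Hz; rewrite (proj2 (transplant_parts D z0 g W z (Hn z Hz))), HA by exact Hz.
    reflexivity. }
  assert (Gv := has_gradient_div D _ _ _ _ _ _ Hn
    (has_gradient_mult D _ _ _ _ _ _ (has_gradient_const D 2)
      (has_gradient_minus D _ _ _ _ _ _ Hpsi (has_gradient_const D (psi z0)))) Gg).
  destruct (C1_on_gradient D v Hv) as [Gv0 [Cvx Cvy]].
  pose proof (has_gradient_ext_loc D _ _ _ _ HD Eu Gu) as Gu'.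
  pose proof (has_gradient_ext_loc D _ _ _ _ HD Ev Gv0) as Gv0'.
  pose proof (has_gradient_ext_loc D _ _ _ _ HD Ev Gv) as Gv'.
  split; [|split].
  - exact (gradient_C1_on D _ _ _ HD Gu' Cux Cuy).
  - exact (gradient_C1_on D _ _ _ HD Gv0' Cvx Cvy).
  - intros z Hz.
    rewrite (has_gradient_dx _ _ _ _ z Gu' Hz), (has_gradient_dy _ _ _ _ z Gu' Hz),
      (has_gradient_dx _ _ _ _ z Gv' Hz), (has_gradient_dy _ _ _ _ z Gv' Hz),
      <- (Eu z Hz), <- (Ev z Hz).
    destruct (transplant_density_components D g W z HD Hn Hg Hu Hz) as [-> ->].
    specialize (Hn z Hz); unfold v; split; field; exact Hn.
Qed.

(** The form is linear in [W] with coefficients that are continuous at [z0]. *)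
Lemma form_bound (D : C -> Prop) (f g : C -> R) (W : C -> C) (z0 : C) :
  open D -> C2_on D f -> C2_on D g -> (forall z, D z -> f z <> 0) -> D z0 ->
  exists K r, 0 <= K /\ 0 < r /\ forall z, square z0 r z ->
    D z /\ Rabs (form_x f g W z) <= K * Cmod (W z) /\ Rabs (form_y f g W z) <= K * Cmod (W z).
Proof.
  intros HD Hf Hg Hn Hz.
  destruct (C1_on_twist D f g HD Hf Hg Hn) as [Kx Ky].
  destruct (proj1 (continuous_square _ z0) (C1_on_continuous D _ HD Kx z0 Hz) 1 Rlt_0_1)
    as [r1 [R1 H1]].
  destruct (proj1 (continuous_square _ z0) (C1_on_continuous D _ HD Ky z0 Hz) 1 Rlt_0_1)
    as [r2 [R2 H2]].
  destruct (proj1 (locally_square D z0) (HD z0 Hz)) as [r0 [R0 H0]].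
  set (k := Rabs (twist_x f g z0)) in *; set (l := Rabs (twist_y f g z0)) in *.
  exists (k + l + 2), (Rmin r0 (Rmin r1 r2)).
  assert (Pk : 0 <= k) by apply Rabs_pos; assert (Pl : 0 <= l) by apply Rabs_pos.
  split; [lra|]; split; [repeat apply Rmin_glb_lt; assumption|].
  intros z Sz.
  pose proof (Rmin_l r0 (Rmin r1 r2)); pose proof (Rmin_r r0 (Rmin r1 r2)).
  pose proof (Rmin_l r1 r2); pose proof (Rmin_r r1 r2).
  assert (sub : forall s, Rmin r0 (Rmin r1 r2) <= s -> square z0 s z)
    by (intros s Hs; destruct Sz; split; lra).
  split; [apply H0, sub; lra|].
  specialize (H1 z (sub r1 ltac:(lra))); specialize (H2 z (sub r2 ltac:(lra))).
  assert (T1 : Rabs (twist_x f g z) <= k + 1).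
  { pose proof (Rabs_triang_inv (twist_x f g z) (twist_x f g z0)); unfold k; lra. }
  assert (T2 : Rabs (twist_y f g z) <= l + 1).
  { pose proof (Rabs_triang_inv (twist_y f g z) (twist_y f g z0)); unfold l; lra. }
  destruct (parts_le_Cmod (W z)) as [Q1 Q2].
  change (fst (W z)) with (Re (W z)) in Q1; change (snd (W z)) with (Im (W z)) in Q2.
  assert (P : forall a b p q, Rabs a <= Cmod (W z) -> Rabs b <= Cmod (W z) ->
            Rabs p + Rabs q <= k + l + 2 -> Rabs (a * p + b * q) <= (k + l + 2) * Cmod (W z)).
  { intros a b p q Ha Hb Hpq; eapply Rle_trans; [apply Rabs_triang|].
    rewrite !Rabs_mult.
    assert (Rabs a * Rabs p <= Cmod (W z) * Rabs p)
      by (apply Rmult_le_compat_r; [apply Rabs_pos | exact Ha]).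
    assert (Rabs b * Rabs q <= Cmod (W z) * Rabs q)
      by (apply Rmult_le_compat_r; [apply Rabs_pos | exact Hb]).
    assert ((Rabs p + Rabs q) * Cmod (W z) <= (k + l + 2) * Cmod (W z))
      by (apply Rmult_le_compat_r; [apply Cmod_ge_0 | exact Hpq]).
    lra. }
  unfold form_x, form_y; split.
  - unfold Rminus; rewrite Ropp_mult_distr_l; apply P; try rewrite Rabs_Ropp; lra.
  - apply P; lra.
Qed.

(** The terms [g Im W] of the potential reproduce [W]; only the primitive of the
    form is left.  [W z0 = 0] removes the boundary term at [z0]. *)
Lemma transplant_difference (D : C -> Prop) (g U : C -> R) (z0 : C) (W : C -> C) (z : C) :
  g z <> 0 -> W z0 = RtoC 0 ->
  Abar D z0 (transplant_density g W) z =
    2 * (density_potential g U W z - density_potential g U W z0) ->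
  (transplant D z0 g W z - W z)%C = (Ci * RtoC (- (U z - U z0) / g z))%C.
Proof.
  intros Hg Z0 HA; destruct (transplant_parts D z0 g W z Hg) as [Tr Ti]; rewrite HA in Ti.
  apply C_ext.
  - change (Re (transplant D z0 g W z) - Re (W z) =
            0 * (- (U z - U z0) / g z) - 1 * 0); rewrite Tr; ring.
  - change (Im (transplant D z0 g W z) - Im (W z) =
            0 * 0 + 1 * (- (U z - U z0) / g z)); rewrite Ti.
    unfold density_potential; rewrite Z0; simpl; field; exact Hg.
Qed.

Theorem theorem13 :
  forall (Om : C -> Prop) (q f g : C -> R) (z0 a : C) (n : nat) (Zf : C -> C),
    simply_connected_domain Om ->
    C2_on Om f -> C2_on Om g ->
    (forall z, Om z -> f z <> 0) -> (forall z, Om z -> g z <> 0) ->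
    schrodinger_solution Om q f -> schrodinger_solution Om q g ->
    Om z0 -> a <> RtoC 0 -> (1 <= n)%nat ->
    is_formal_power Om f n a z0 Zf ->
    (forall z, Om z ->
       exists! v : R, is_Abar Om z0 (transplant_density g Zf) z v) /\
    is_formal_power Om g n a z0 (transplant Om z0 g Zf).
Proof.
  intros Om q f g z0 a n Zf Hsc Hf Hg Hfn Hgn Sf Sg Hz0 Ha Hn [HW HZ].
  pose proof (proj1 Hsc) as HD; pose proof (proj1 Hg) as Hg1; pose proof HW as [Hu [Hv _]].
  destruct (C1_on_form Om f g Zf HD Hf Hg Hfn HW) as [HA HB].
  destruct (closed_form_primitive Om _ _ Hsc HA HB
    (form_closed Om q f g Zf HD Hf Hg Hfn Sf Sg HW)) as [U HU].
  pose proof (density_potential_gradient Om f g U Zf HD Hg1 Hfn Hgn HW HU) as Hpsi.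
  destruct (continuous_in_density Om g Zf HD Hgn Hg1 Hu) as [Cr Cim].
  set (psi := density_potential g U Zf) in *.
  pose proof (fun z => is_Abar_gradient Om _ psi z0 z Hsc Hpsi Cr Cim Hz0) as HAbar.
  assert (EAbar : forall z, Om z ->
            Abar Om z0 (transplant_density g Zf) z = 2 * (psi z - psi z0)).
  { intros z Hz; destruct (HAbar z Hz) as [Hex Huniq].
    apply (iota_unique (V := R_CompleteNormedModule)); assumption. }
  split; [|split].
  - intros z Hz; exists (2 * (psi z - psi z0)); destruct (HAbar z Hz) as [Hex Huniq].
    split; [exact Hex|]; intros v Hv'; symmetry; exact (Huniq v Hv').
  - exact (transplant_vekua Om g psi z0 Zf HD Hg1 Hgn Hu Hpsi EAbar).
  - assert (Z0 : Zf z0 = RtoC 0).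
    { apply (asymptotic_power_center n a); try assumption;
        [apply (C1_on_continuous Om _ HD Hu) | apply (C1_on_continuous Om _ HD Hv)]; exact Hz0. }
    destruct (asymptotic_power_bound n a z0 Zf Ha HZ) as [r1 [R1 B1]].
    destruct (form_bound Om f g Zf z0 HD Hf Hg Hfn Hz0) as [K [r2 [HK [R2 B2]]]].
    pose proof (Hgn z0 Hz0) as Hg0.
    (* Near the centre [1 / |g|] is at most [1 / (|g z0| / 2)]. *)
    assert (Pg : 0 < Rabs (g z0) / 2) by (pose proof (Rabs_pos_lt _ Hg0); lra).
    destruct (proj1 (continuous_square g z0) (C1_on_continuous Om g HD Hg1 z0 Hz0) _ Pg)
      as [r3 [R3 B3]].
    set (r := Rmin r1 (Rmin r2 r3)).
    assert (Hr : 0 < r /\ r <= r1 /\ r <= r2 /\ r <= r3).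
    { unfold r; pose proof (Rmin_l r1 (Rmin r2 r3)); pose proof (Rmin_r r1 (Rmin r2 r3)).
      pose proof (Rmin_l r2 r3); pose proof (Rmin_r r2 r3).
      split; [repeat apply Rmin_glb_lt; assumption | lra]. }
    assert (sub : forall s z, r <= s -> square z0 r z -> square z0 s z)
      by (intros s z Hs [? ?]; split; lra).
    pose (M := K * (2 * Cmod a)).
    pose proof (Cmod_ge_0 a) as Pa.
    assert (HM : 0 <= M) by (unfold M; nra).
    assert (HZb : forall z, square z0 r z -> Cmod (Zf z) <= 2 * Cmod a * Cmod (z - z0)%C ^ n).
    { intros z Sz; destruct (classic (z = z0)) as [->|Hne].
      - rewrite Z0, Cmod_0; apply Rmult_le_pos; [lra | apply pow_le, Cmod_ge_0].
      - apply B1; [apply (sub r1); tauto | exact Hne]. }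
    assert (HUb : forall z, square z0 r z ->
              Rabs (U z - U z0) <= 2 * M * Cmod (z - z0)%C ^ S n).
    { apply (primitive_order Om U _ _ z0 n M r HU HM).
      intros w Sw; destruct (B2 w (sub r2 w ltac:(tauto) Sw)) as [Dw [Aw Bw]].
      specialize (HZb w Sw).
      assert (K * Cmod (Zf w) <= M * Cmod (w - z0)%C ^ n)
        by (unfold M; rewrite Rmult_assoc; apply Rmult_le_compat_l; lra).
      split; [exact Dw|]; lra. }
    apply (asymptotic_power_perturb n a z0 Zf _ (2 * M / (Rabs (g z0) / 2)) r Ha HZ (proj1 Hr)).
    intros z Sz.
    destruct (B2 z (sub r2 z ltac:(tauto) Sz)) as [Dz _].
    rewrite (transplant_difference Om g U z0 Zf z (Hgn z Dz) Z0 (EAbar z Dz)).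
    rewrite Cmod_mult, Cmod_Ci, Cmod_R, Rmult_1_l; unfold Rdiv at 1.
    rewrite Rabs_mult, Rabs_Ropp, Rabs_inv.
    specialize (HUb z Sz); specialize (B3 z (sub r3 z ltac:(tauto) Sz)).
    assert (Lg : Rabs (g z0) / 2 <= Rabs (g z)).
    { pose proof (Rabs_triang_inv (g z0) (g z)); rewrite Rabs_minus_sym in B3; lra. }
    replace (2 * M / (Rabs (g z0) / 2) * Cmod (z - z0)%C ^ S n) with
      (2 * M * Cmod (z - z0)%C ^ S n * / (Rabs (g z0) / 2)) by (unfold Rdiv; ring).
    apply Rmult_le_compat; [apply Rabs_pos | left; apply Rinv_0_lt_compat; lra | exact HUb |].
    apply Rinv_le_contravar; lra.
Qed.
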